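(* Suppose that $M$ is a compact, oriented $3$-manifold with a (possibly partially ideal) triangulation consisting of $t$ tetrahedra. Then $$LTV(M)\leqslant 2.08\, v_8\, t,$$ where $v_8\simeq 3.6638$ is the volume of a regular ideal hyperbolic octahedron and $LTV(M)=\limsup_{r\to\infty,\ r\text{ odd}}\frac{2\pi}{r}\log|TV_r(M)|$.
   Context: **Turaev--Viro invariants.** Let $r\geqslant 3$ be an odd integer, $q=e^{2\pi i/r}$. Put $\{n\}=2\sin(2n\pi/r)$, $[n]=\frac{q^n-q^{-n}}{q-q^{-1}}=\frac{\sin(2n\pi/r)}{\sin(2\pi/r)}$, $\{n\}!=\prod_{i=1}^n\{i\}$ (with $\{0\}!=1$), $\zeta_r=2\sin(2\pi/r)$, $\eta_r=\frac{2\sin(2\pi/r)}{\sqrt r}$. Let $I_r=\{0,2,4,\dots,r-3\}$. A triple $(a_i,a_j,a_k)$ in $I_r$ is admissible if $a_i+a_j+a_k\leqslant 2(r-2)$ and $a_i\leqslant a_j+a_k$, $a_j\leqslant a_i+a_k$, $a_k\leqslant a_i+a_j$. For an admissible triple, $$\Delta(a_i,a_j,a_k)=\zeta_r^{1/2}\left(\frac{\{\frac{a_i+a_j-a_k}{2}\}!\,\{\frac{a_j+a_k-a_i}{2}\}!\,\{\frac{a_i+a_k-a_j}{2}\}!}{\{\frac{a_i+a_j+a_k}{2}+1\}!}\right)^{1/2}$$ (with $\sqrt{x}=\sqrt{-1}\sqrt{|x|}$ for real $x<0$). A $6$-tuple $(a_1,\dots,a_6)\in I_r^6$ is admissible if $F_1=(a_1,a_2,a_3)$,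 $F_2=(a_2,a_4,a_6)$, $F_3=(a_1,a_5,a_6)$, $F_4=(a_3,a_4,a_5)$ are admissible. Its quantum $6j$-symbol is $$\begin{vmatrix}a_1&a_2&a_3\\ a_4&a_5&a_6\end{vmatrix}=\zeta_r^{-1}(\sqrt{-1})^{\lambda}\prod_{i=1}^4\Delta(F_i)\sum_{z=\max\{T_1,\dots,T_4\}}^{\min\{Q_1,Q_2,Q_3\}}\frac{(-1)^z\{z+1\}!}{\prod_{j=1}^4\{z-T_j\}!\prod_{k=1}^3\{Q_k-z\}!},$$ where $\lambda=\sum a_i$, $T_1=\frac{a_1+a_2+a_3}2$, $T_2=\frac{a_1+a_5+a_6}2$, $T_3=\frac{a_2+a_4+a_6}2$, $T_4=\frac{a_3+a_4+a_5}2$, $Q_1=\frac{a_1+a_2+a_4+a_5}2$, $Q_2=\frac{a_1+a_3+a_4+a_6}2$, $Q_3=\frac{a_2+a_3+a_5+a_6}2$. Let $M$ be a compact orientable $3$-manifold and $\tau$ a triangulation of $M$; if $\partial M\ne\emptyset$, $\tau$ is allowed to be (partially) ideal: some vertices of the tetrahedra are truncated and the truncated faces triangulate $\partial M$. Let $V$ be the set of vertices of $\tau$ not on $\partial M$ and $E$ the set of interior edges (edges created by truncation are excluded). An admissible coloring $c\in A_r(\tau)$ assigns elements of $I_r$ to the edges so that for each tetrahedron the resulting $6$-tuple is admissible (the triples $F_i$ being the colors of the edges of the four faces). Put $|e|_c=(-1)^{c(e)}[c(e)+1]$ and let $|\Delta|_c$ be the $6j$-symbol of the $6$-tuple of colors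 of the tetrahedron $\Delta$. Then $$TV_r(M)=2^{b_2-b_0}\,\eta_r^{2|V|}\sum_{c\in A_r(\tau)}\prod_{e\in E}|e|_c\prod_{\Delta\in\tau}|\Delta|_c,$$ where $b_2$ is the second $\mathbb Z_2$-Betti number of $M$ and $b_0$ the number of closed connected components of $M$; this is independent of $\tau$. By convention $\log 0=-\infty$. *)

(* Defs.v *)
From HB Require Import structures.
From mathcomp Require Import all_boot all_order all_algebra all_fingroup.
From mathcomp Require Import all_classical all_reals all_analysis.
From mathcomp Require Import finmap complex.
Import Order.TTheory GRing.Theory Num.Theory numFieldNormedType.Exports.

Set Implicit Arguments.
Unset Strict Implicit.
Unset Printing Implicit Defensive.

Local Open Scope classical_set_scope.
Local Open Scope ring_scope.

Definition std_simplex (R : realType) (n : nat) : set 'rV[R]_n.+1 :=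
  [set x | (forall j, 0 <= x ord0 j) /\ \sum_j x ord0 j = 1].
Arguments std_simplex : clear implicits.

Definition face_row (R : realType) (n : nat) (i : 'I_n.+2) (x : 'rV[R]_n.+1)
    : 'rV[R]_n.+2 :=
  \row_j (if unlift i j is Some k then x ord0 k else 0).

Lemma face_row_simplex (R : realType) (n : nat) (i : 'I_n.+2)
    (x : std_simplex R n) : face_row i (set_val x) \in std_simplex R n.+1.
Proof.
have [x0 x1] := set_valP x.
apply/mem_set; split=> [j|].
  by rewrite mxE; case: unlift.
rewrite (bigD1_ord i) //= mxE unlift_none add0r -x1.
by apply: eq_bigr => k _; rewrite mxE liftK.
Qed.

Definition face_map (R : realType) (n : nat) (i : 'I_n.+2)
    (x : std_simplex R n) : std_simplex R n.+1 :=
  exist _ (face_row i (set_val x)) (face_row_simplex i x).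

(** The coefficient functions of singular chains are those satisfying
    [singular_chain]; the type below also contains non-continuous simplices and
    infinite supports. *)
Definition prechain (R : realType) (A : comNzRingType) (X : topologicalType)
    (n : nat) : Type :=
  (std_simplex R n -> X) -> A.

Section SingularHomology.
Variables (R : realType) (A : comNzRingType) (X : topologicalType).
Local Notation prechain := (prechain R A X).

Definition singular_chain n (c : prechain n) : Prop :=
  finite_set [set s | c s != 0] /\ (forall s, c s != 0 -> continuous s).

Definition bd n (c : prechain n.+1) : prechain n := fun s =>
  \sum_(u \in [set: std_simplex R n.+1 -> X])
    \sum_(i < n.+2) (if u \o face_map i == s then (-1) ^+ i * c u else 0).

Definition is_cycle n (c : prechain n.+1) : Prop :=
  singular_chain c /\ bd c = (fun=> 0).

Definition is_boundary n (c : prechain n) : Prop :=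
  exists2 d : prechain n.+1, singular_chain d & bd d = c.

(** [b] cycles form a basis of the homology group of degree [n.+1]. *)
Definition is_betti n (b : nat) : Prop :=
  exists z : 'I_b -> prechain n.+1, (forall i, is_cycle (z i)) /\
    forall c, is_cycle c ->
      exists! k : 'rV[A]_b,
        is_boundary (fun s => c s - \sum_(i < b) k ord0 i * z i s).

Definition avoids n (B : set X) (c : prechain n) : Prop :=
  forall s, c s != 0 -> forall p, ~ B (s p).

(** [c] and [c'] are homologous modulo chains of the complement of [B]. *)
Definition rel_homologous n (B : set X) (c c' : prechain n) : Prop :=
  exists (d : prechain n.+1) (e : prechain n),
    [/\ singular_chain d, singular_chain e, avoids B e &
        forall s, c s - c' s = bd d s + e s].

(** [c] is a relative cycle generating H_n+1(X, X \ {x}). *)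
Definition local_generator n (x : X) (c : prechain n.+1) : Prop :=
  [/\ singular_chain c, avoids [set x] (bd c) &
      forall z : prechain n.+1, singular_chain z -> avoids [set x] (bd z) ->
        exists k : A, rel_homologous [set x] z (fun s => k * c s)].

End SingularHomology.

(** The value is the junk 0 if the homology group is not finitely generated. *)
Definition betti2 (R : realType) (X : topologicalType) : nat :=
  get (fun b => @is_betti R 'F_2 X 1 b).

Definition homeomorphic_sets (X Y : topologicalType) (U : set X) (V : set Y)
    : Prop :=
  exists (f : X -> Y) (g : Y -> X),
    [/\ {within U, continuous f} /\ {within V, continuous g},
        set_fun U V f, set_fun V U g,
        {in U, cancel f g} & {in V, cancel g f}].

Definition half_space (R : realType) : set 'rV[R]_3 :=
  [set x | 0 <= x ord0 ord0].

Arguments half_space : clear implicits.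

Definition compact_3manifold (R : realType) (M : topologicalType) : Prop :=
  [/\ hausdorff_space M, @second_countable M, compact [set: M] &
      forall x : M, exists (U : set M) (W : set 'rV[R]_3),
        [/\ open U, U x, open W & homeomorphic_sets U (W `&` half_space R)]].

Definition mfd_interior (R : realType) (M : topologicalType) : set M :=
  [set x | exists (U : set M) (W : set 'rV[R]_3),
     [/\ open U, U x, open W & homeomorphic_sets U W]].

Arguments mfd_interior : clear implicits.

Definition mfd_boundary (R : realType) (M : topologicalType) : set M :=
  ~` mfd_interior R M.
Arguments mfd_boundary : clear implicits.

(** A locally consistent choice of generators of H_3(M, M \ {x}; Z), for x in
    the interior of M. *)
Definition is_orientation (R : realType) (M : topologicalType)
    (o : M -> prechain R int M 3) : Prop :=
  forall x : M, mfd_interior R M x ->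
    local_generator x (o x) /\
    exists (U : set M) (c : prechain R int M 3),
      [/\ open U, U x, singular_chain c, avoids U (bd c) &
          forall y, U y -> mfd_interior R M y ->
            rel_homologous [set y] c (o y)].

Definition closed_components (R : realType) (M : topologicalType)
    : set (set M) :=
  [set C | (exists x : M, C = connected_component [set: M] x) /\
           C `&` mfd_boundary R M = set0].

Arguments closed_components : clear implicits.

Definition betti0 (R : realType) (M : topologicalType) : nat :=
  (#|` fset_set (closed_components R M)|)%fset.

(** [t] tetrahedra with vertices [0..3]; face [f] is the face opposite to the
    vertex [f]. Face [f] of [i] is glued to face [glue_perm i f f] of
    [glue_tet i f], each vertex [v != f] going to [glue_perm i f v]. Every face
    is glued: the boundary only comes from the truncated vertices. *)
Record gluing (t : nat) := Gluing {
  trunc : 'I_t -> pred 'I_4;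
  glue_tet : 'I_t -> 'I_4 -> 'I_t;
  glue_perm : 'I_t -> 'I_4 -> 'S_4;
  glue_tetK : forall i f, glue_tet (glue_tet i f) (glue_perm i f f) = i;
  glue_permK : forall i f,
    glue_perm (glue_tet i f) (glue_perm i f f) = (glue_perm i f)^-1%g;
  glue_neq : forall i f, (glue_tet i f, glue_perm i f f) <> (i, f);
  glue_trunc : forall i f v, v != f ->
    trunc (glue_tet i f) (glue_perm i f v) = trunc i v
}.

Section Realization.
Variables (R : realType) (t : nat) (tau : gluing t).

(** Truncating at barycentric coordinate 2/3 keeps the truncation triangles
    disjoint. *)
Definition truncated_tet (i : 'I_t) : set 'rV[R]_4 :=
  [set x | std_simplex R 3 x /\
     forall v, trunc tau i v -> x ord0 v <= 2%:R / 3%:R].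

Definition truncation_faces (i : 'I_t) : set 'rV[R]_4 :=
  [set x | truncated_tet i x /\
     exists2 v, trunc tau i v & x ord0 v = 2%:R / 3%:R].

Definition face_step (p q : 'I_t * 'rV[R]_4) : Prop :=
  exists f : 'I_4, [/\ p.2 ord0 f = 0, q.1 = glue_tet tau p.1 f &
    forall v, q.2 ord0 (glue_perm tau p.1 f v) = p.2 ord0 v].

Inductive glued : 'I_t * 'rV[R]_4 -> 'I_t * 'rV[R]_4 -> Prop :=
| glued_refl p : glued p p
| glued_step p q s : face_step p q -> glued q s -> glued p s.

(** Since M is Hausdorff and the truncated tetrahedra are compact, the
    conditions say that M is homeomorphic to the quotient of the disjoint union
    of the truncated tetrahedra by the face gluings. *)
Definition triangulates (M : topologicalType) : Prop :=
  exists phi : 'I_t -> 'rV[R]_4 -> M,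
    [/\ forall i, {within truncated_tet i, continuous (phi i)},
        forall p : M, exists i, (phi i @` truncated_tet i) p,
        forall i j x y, truncated_tet i x -> truncated_tet j y ->
          (phi i x = phi j y <-> glued (i, x) (j, y)) &
        mfd_boundary R M = \bigcup_i (phi i @` truncation_faces i)].

End Realization.

Definition tet_edge := {A : {set 'I_4} | #|A| == 2%N}.

Lemma card_pair (u v : 'I_4) : u != v -> #|[set u; v]%SET| == 2%N.
Proof. by move=> uv; rewrite cards2 uv. Qed.

Definition pair_edge (u v : 'I_4) (uv : u != v) : tet_edge :=
  exist (fun A : {set 'I_4} => #|A| == 2%N) _ (card_pair uv).

Section Cells.
Variables (t : nat) (tau : gluing t).

Definition vertex_glue : rel ('I_t * 'I_4) := fun p q =>
  [exists f, [&& f != p.2, q.1 == glue_tet tau p.1 f &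
                 q.2 == glue_perm tau p.1 f p.2]].

Definition edge_glue : rel ('I_t * tet_edge) := fun p q =>
  [exists f, [&& f \notin val p.2, q.1 == glue_tet tau p.1 f &
                 val q.2 == (glue_perm tau p.1 f @: val p.2)%SET]].

Definition num_vertices : nat :=
  n_comp vertex_glue [pred p | ~~ trunc tau p.1 p.2].

End Cells.

Section TuraevViro.
Variables (R : realType) (r : nat).
Local Notation C := (complex R).
Local Open Scope complex_scope.

Definition curly (n : nat) : R := 2%:R * sin ((2 * n)%:R * pi / r%:R).

Definition qint (n : nat) : R :=
  sin ((2 * n)%:R * pi / r%:R) / sin (2%:R * pi / r%:R).

Definition curly_fact (n : nat) : R := \prod_(1 <= i < n.+1) curly i.

Definition zeta : R := 2%:R * sin (2%:R * pi / r%:R).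

Definition eta : R := 2%:R * sin (2%:R * pi / r%:R) / Num.sqrt r%:R.

Definition csqrt (x : R) : C :=
  if 0 <= x then (Num.sqrt x)%:C else 'i * (Num.sqrt `|x|)%:C.

Definition in_I (a : nat) : bool := ~~ odd a && (a <= r - 3)%N.

Definition admissible3 (a b c : nat) : bool :=
  [&& in_I a, in_I b, in_I c, (a + b + c <= 2 * (r - 2))%N,
      (a <= b + c)%N, (b <= a + c)%N & (c <= a + b)%N].

Definition Delta (a b c : nat) : C :=
  csqrt zeta *
  csqrt (curly_fact ((a + b - c)./2) * curly_fact ((b + c - a)./2) *
         curly_fact ((a + c - b)./2) / curly_fact ((a + b + c)./2.+1)).

Definition admissible6 (a1 a2 a3 a4 a5 a6 : nat) : bool :=
  [&& admissible3 a1 a2 a3, admissible3 a2 a4 a6,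
      admissible3 a1 a5 a6 & admissible3 a3 a4 a5].

Definition sixj (a1 a2 a3 a4 a5 a6 : nat) : C :=
  let T1 := (a1 + a2 + a3)./2 in
  let T2 := (a1 + a5 + a6)./2 in
  let T3 := (a2 + a4 + a6)./2 in
  let T4 := (a3 + a4 + a5)./2 in
  let Q1 := (a1 + a2 + a4 + a5)./2 in
  let Q2 := (a1 + a3 + a4 + a6)./2 in
  let Q3 := (a2 + a3 + a5 + a6)./2 in
  (zeta^-1)%:C * 'i ^+ (a1 + a2 + a3 + a4 + a5 + a6) *
  (Delta a1 a2 a3 * Delta a2 a4 a6 * Delta a1 a5 a6 * Delta a3 a4 a5) *
  (\sum_(maxn (maxn T1 T2) (maxn T3 T4) <= z < (minn Q1 (minn Q2 Q3)).+1)
     (-1) ^+ z * curly_fact z.+1 /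
     (curly_fact (z - T1) * curly_fact (z - T2) *
      curly_fact (z - T3) * curly_fact (z - T4) *
      (curly_fact (Q1 - z) * curly_fact (Q2 - z) * curly_fact (Q3 - z))))%:C.

Definition edge_weight (a : nat) : R := (-1) ^+ a * qint a.+1.

Section State.
Variables (t : nat) (tau : gluing t).

Definition v0 : 'I_4 := @Ordinal 4 0 isT.
Definition v1 : 'I_4 := @Ordinal 4 1 isT.
Definition v2 : 'I_4 := @Ordinal 4 2 isT.
Definition v3 : 'I_4 := @Ordinal 4 3 isT.

(** The triples F_1, F_2, F_3, F_4 are the faces opposite to the vertices
    0, 1, 2, 3, so that, e.g., a_1, the common edge of F_1 and F_3, is the edge
    13. *)
Definition on_six_edges (T : Type) (F : nat -> nat -> nat -> nat -> nat -> nat -> T)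
    (c : 'I_t * tet_edge -> nat) (i : 'I_t) : T :=
  F (c (i, @pair_edge v1 v3 isT)) (c (i, @pair_edge v2 v3 isT))
    (c (i, @pair_edge v1 v2 isT)) (c (i, @pair_edge v0 v2 isT))
    (c (i, @pair_edge v0 v1 isT)) (c (i, @pair_edge v0 v3 isT)).

(** A coloring of the edges of the triangulation is a coloring of the edges of
    the tetrahedra that is compatible with the face gluings. *)
Definition admissible_coloring (c : {ffun 'I_t * tet_edge -> 'I_r}) : bool :=
  [forall p, [forall q, edge_glue tau p q ==> (c p == c q)]] &&
  [forall i, on_six_edges admissible6 (fun p => nat_of_ord (c p)) i].

(** The edges of the triangulation are represented by the roots of their
    classes. *)
Definition TV (M : topologicalType) : C :=
  2%:R ^ ((betti2 R M)%:Z - (betti0 R M)%:Z) *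
  (eta ^+ (2 * num_vertices tau))%:C *
  \sum_(c | admissible_coloring c)
    ((\prod_(p in roots (edge_glue tau)) edge_weight (c p))%:C *
     \prod_(i < t) on_six_edges sixj (fun p => nat_of_ord (c p)) i).

End State.
End TuraevViro.

(** The sequence runs over the odd integers r = 2n + 3. *)
Definition LTV (R : realType) (t : nat) (tau : gluing t) (M : topologicalType)
    : \bar R :=
  limn_esup (fun n : nat =>
    let r := (2 * n + 3)%N in
    ((2%:R * pi / r%:R)%:E *
     lne (ComplexField.Normc.normc (TV R r tau M))%:E)%E).

Section Octahedron.
Variable R : realType.

Definition sqnorm3 (p : R * R * R) : R :=
  p.1.1 ^+ 2 + p.1.2 ^+ 2 + p.2 ^+ 2.

(** In the Klein ball model of the hyperbolic 3-space, geodesic convexity is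
    Euclidean convexity and the volume form is
    (1 - |x|^2)^-2 dx_1 dx_2 dx_3. *)
Definition hyperbolic_volume (A : set (R * R * R)) : \bar R :=
  let mu := @lebesgue_measure R in
  (\int[((mu \x mu) \x mu)%E]_(p in A) ((1 - sqnorm3 p) ^- 2)%:E)%E.

(** The convex hull of the six ideal points e_1, -e_1, e_2, -e_2, e_3, -e_3,
    without these points. *)
Definition regular_ideal_octahedron : set (R * R * R) :=
  [set p | `|p.1.1| + `|p.1.2| + `|p.2| <= 1 /\ sqnorm3 p < 1].

Definition v8 : \bar R := hyperbolic_volume regular_ideal_octahedron.

End Octahedron.

(* Main.v *)
Require Import Defs.
From HB Require Import structures.
From mathcomp Require Import all_boot all_order all_algebra.
From mathcomp Require Import all_classical all_reals all_analysis.
From mathcomp Require Import measurable_realfun complex ring lra zify.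
Import Order.TTheory GRing.Theory Num.Theory numFieldNormedType.Exports.

Set Implicit Arguments.
Unset Strict Implicit.
Unset Printing Implicit Defensive.

Local Open Scope classical_set_scope.
Local Open Scope ring_scope.

(** Let [h = 2 pi / r] and [r = 2 N + 1]. Since the products of sines in
    [{n}!] satisfy [|{n}!| |{r - 1 - n}!| = r], every Delta and every term of a
    6j-symbol is, up to powers of [r], a product of inverses [|{n_i}!|^-1]: four
    of them with [sum n_i = 3 r - 2] (the squared Delta), respectively eight
    with [sum n_i = r - 2] (the summand). Each inverse is bounded by
    [exp (c / h - e_i / 10)] up to powers of [r], where [c = 33 / 50] and
    [e_i] is [2 n_i] reduced modulo [r]; the linear correction [e_i / 10] is
    controlled by the constraint on [sum n_i]. Adding up, a 6j-symbol is at most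
    [exp ((16 c - pi) r / (2 pi))] up to powers of [r], and [16 c - pi <= 7.56].

    Conversely, coning the ideal octahedron to an ideal vertex with
    [x = (1 - z) X], [y = (1 - z) (1 - X) Y] turns its volume into an integral
    over the unit cube; integrating out [z] and expanding a geometric series
    gives [v8 >= 2 sum_k m_k / (k + 1)] where
    [m_k = int_0^1 ((1 + y^2) / 2)^k dy >= 1 / k] for [k >= 3]. Thus
    [v8 >= 3.635] and [2.08 v8 >= 7.56]. *)

(** * A lower bound on the volume of the octahedron *)

Section Scaling.
Variable R : realType.
Local Notation mu := (@lebesgue_measure R).
Local Open Scope ereal_scope.

(** [c] times the pushforward of Lebesgue measure under multiplication by [c] agrees with Lebesgue
    measure on half-open intervals, hence everywhere. *)
Lemma ge0_integral_dilation (c : R) (g : R -> \bar R) : (0 < c)%R ->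
  measurable_fun [set: R] g -> (forall x, 0 <= g x) ->
  \int[mu]_x g x = c%:E * \int[mu]_x g (c * x)%R.
Proof.
move=> c0 mg g0.
pose phi : measurableTypeR R -> measurableTypeR R := *%R c.
have mphi : measurable_fun setT phi by apply: mulrl_measurable.
have := @ge0_integral_pushforward _ _ _ _ R phi mphi mu setT g measurableT mg.
rewrite preimage_setT => <-; last by move=> *; exact: g0.
rewrite -[c]/((NngNum (ltW c0))%:num) -ge0_integral_mscale//.
apply: eq_measure_integral => A mA _.
apply: lebesgue_measure_unique => //= _ [[a b]] _ <-.
rewrite /mscale /= /pushforward.
have -> : phi @^-1` `]a, b] = `](a / c)%R, (b / c)%R]%classic.
  apply/seteqP; split=> x; rewrite /= !in_itv /= /phi;
    by rewrite ltr_pdivrMr// ler_pdivlMr// mulrC.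
rewrite !lebesgue_measure_itv /= !lte_fin ltr_pM2r ?invr_gt0//.
case: ifPn => _; last by rewrite mule0.
by rewrite -!EFinD -EFinM; congr EFin; field; rewrite gt_eqF.
Qed.

Lemma ge0_even_integral_dilation (c : R) (g : R -> \bar R) : (0 < c)%R ->
  measurable_fun [set: R] g -> (forall x, 0 <= g x) ->
  (forall x, g (- x)%R = g x) ->
  \int[mu]_(x in `]0%R, 1%R[) ((2 * c)%:E * g (c * x)%R) <= \int[mu]_x g x.
Proof.
move=> c0 mg g0 ge.
rewrite (ge0_integral_dilation c0)//.
set f := fun x => g (c * x)%R.
have mf : measurable_fun [set: R] f.
  by apply: (measurableT_comp mg); apply: mulrl_measurable.
have f0 x : 0 <= f x by apply: g0.
rewrite ge0_integralZl//; last 2 first.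
- exact: measurable_funTS.
- by rewrite lee_fin mulr_ge0// ltW.
rewrite mulrC EFinM -muleA lee_pmul2l//.
have -> : [set: R] = `[0%R, +oo[%classic `|` `]-oo, 0%R[%classic.
  by rewrite setUC -itv_bndbnd_setU// set_itvNyy.
rewrite ge0_integral_setU//=; last 2 first.
- exact: measurable_funTS.
- apply/disj_set2P; apply/seteqP; split=> x //= [].
  by rewrite !in_itv/= andbT => /le_lt_trans h /h; rewrite ltxx.
rewrite [X in _ + X]integral_itv_bndo_bndc; last exact: measurable_funTS.
rewrite [X in _ + X](_ : _ = \int[mu]_(x in `[0%R, +oo[) f x); last first.
  rewrite ge0_integration_by_substitution0//.
  by apply: eq_integral => x _; rewrite /f mulrN ge.
rewrite mule_natl mule2n; apply: leeD; apply: ge0_subset_integral => //.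
all: try exact: measurable_funTS.
all: by move=> x; rewrite /= !in_itv/= andbT => /andP[/ltW].
Qed.

(** One coordinate of the substitution: [h] lives on the unit interval, and [2 * c] combines the two
    signs with the Jacobian. An inequality suffices for a lower bound on the volume. *)
Lemma ge0_even_integral_ge (c : R) (g h : R -> \bar R) : (0 < c)%R ->
  measurable_fun [set: R] g -> (forall x, 0 <= g x) ->
  (forall x, g (- x)%R = g x) ->
  measurable_fun [set: R] h -> (forall x, 0 <= h x) ->
  (forall x, ~ `]0%R, 1%R[%classic x -> h x = 0) ->
  (forall x, `]0%R, 1%R[%classic x -> h x <= (2 * c)%:E * g (c * x)%R) ->
  \int[mu]_x h x <= \int[mu]_x g x.
Proof.
move=> c0 mg g0 ge mh h0 hout hin.
apply: le_trans (ge0_even_integral_dilation c0 mg g0 ge).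
have -> : \int[mu]_x h x = \int[mu]_(x in `]0%R, 1%R[) h x.
  rewrite [RHS]integral_mkcond; apply: eq_integral => x _.
  by rewrite patchE; case: ifPn => // /negP xI; apply: hout => /mem_set.
apply: ge0_le_integral => //.
- exact: measurable_funTS.
- apply: measurable_funTS; apply: emeasurable_funM => //.
  by apply: (measurableT_comp mg); apply: mulrl_measurable.
Qed.

Lemma integral_01_FTC2 (f F : R -> R) :
  (forall x : R, (0 <= x <= 1)%R -> is_derive x (1%R : R) F (f x)) ->
  (forall x : R, (0 <= x <= 1)%R -> derivable f x 1%R) ->
  \int[mu]_(x in `]0%R, 1%R[) (f x)%:E = (F 1 - F 0)%:E.
Proof.
move=> dF df.
have cdf : {in `[0%R, 1%R], forall x, derivable f x 1%R}.
  by move=> x; rewrite in_itv /=; exact: df.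
have cF (x : R) : (0 <= x <= 1)%R -> {for x, continuous F}.
  move=> x01; apply: differentiable_continuous; apply/derivable1_diffP.
  by have [] := dF x x01.
have mf : measurable_fun (`]0%R, 1%R[%classic : set R) (EFin \o f).
  apply/measurable_EFinP; apply: open_continuous_measurable_fun => //.
  move=> x; rewrite inE /= in_itv /= => /andP[x0 x1].
  apply: differentiable_continuous; apply/derivable1_diffP.
  by apply: df; rewrite !ltW.
rewrite -(integral_itv_bndoo true false)//.
rewrite (@continuous_FTC2 _ f F)//.
- exact: derivable_within_continuous.
- split.
  + move=> x; rewrite in_itv /= => /andP[x0 x1].
    by have [] := dF x (introT andP (conj (ltW x0) (ltW x1))).
  + by apply: cvg_at_right_filter; apply: cF; rewrite lexx ler01.
  + by apply: cvg_at_left_filter; apply: cF; rewrite lexx ler01.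
- move=> x; rewrite in_itv /= => /andP[x0 x1]; rewrite derive1E.
  by have [_ ->] := dF x (introT andP (conj (ltW x0) (ltW x1))).
Qed.

End Scaling.

(** * Substitution from the unit cube to an octant *)

Section OctantSubstitution.
Variable R : realType.
Local Notation mu := (@lebesgue_measure R).

Lemma measurable_fun_inv : measurable_fun [set: R] (@GRing.inv R).
Proof.
(* Measurability comes from that of the power function; the factor [x] restores the sign, and both
   sides vanish at 0. *)
rewrite (_ : @GRing.inv R = fun x => x * (x ^+ 2) `^ (-1)).
  apply: measurable_funM => //.
  by apply: (@measurableT_comp _ _ _ _ _ _ (fun y : R => y `^ (-1))).
apply/funext => x; rewrite powR_inv1 ?sqr_ge0//.
have [->|x0] := eqVneq x 0; first by rewrite invr0 mul0r.
by rewrite expr2 invfM mulrA mulfV// mul1r.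
Qed.

Lemma measurable_funV d (T : measurableType d) (f : T -> R) :
  measurable_fun setT f -> measurable_fun setT (fun x => (f x)^-1).
Proof. by move=> mf; exact: (measurableT_comp measurable_fun_inv). Qed.

Lemma measurable_sqnorm3 : measurable_fun [set: R * R * R] (@sqnorm3 R).
Proof.
have m1 : measurable_fun [set: R * R * R] (fun p : R * R * R => p.1.1).
  exact: (measurableT_comp measurable_fst measurable_fst).
have m2 : measurable_fun [set: R * R * R] (fun p : R * R * R => p.1.2).
  exact: (measurableT_comp measurable_snd measurable_fst).
apply: measurable_funD; [apply: measurable_funD|]; apply: measurable_funX => //.
Qed.

Lemma measurable_octahedron : measurable (@regular_ideal_octahedron R).
Proof.
have m1 : measurable_fun [set: R * R * R] (fun p : R * R * R => p.1.1).
  exact: (measurableT_comp measurable_fst measurable_fst).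
have m2 : measurable_fun [set: R * R * R] (fun p : R * R * R => p.1.2).
  exact: (measurableT_comp measurable_snd measurable_fst).
have mn : measurable_fun [set: R * R * R]
    (fun p : R * R * R => `|p.1.1| + `|p.1.2| + `|p.2|).
  apply: measurable_funD; [apply: measurable_funD|];
    exact: (measurableT_comp (@normr_measurable _ _)).
rewrite (_ : @regular_ideal_octahedron R =
  ((fun p : R * R * R => `|p.1.1| + `|p.1.2| + `|p.2|) @^-1` `]-oo, 1]) `&`
  (@sqnorm3 R @^-1` `]-oo, 1[)).
  apply: measurableI; rewrite -[X in measurable X]setTI.
  - exact: mn.
  - exact: measurable_sqnorm3.
by apply/seteqP; split=> p /=; rewrite !in_itv.
Qed.

(** Eight times the hyperbolic density in the coordinates
    [x = (1 - z) X], [y = (1 - z) (1 - X) Y] of the positive octant, including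
    the Jacobian [(1 - z) ^ 2 (1 - X)]; the argument is [((X, Y), z)]. *)
Definition octant_density (p : R * R * R) : R :=
  8 * (1 - p.1.1) *
  ((1 - (p.1.1 ^+ 2 + (1 - p.1.1) ^+ 2 * p.1.2 ^+ 2)) +
   p.2 * (1 + (p.1.1 ^+ 2 + (1 - p.1.1) ^+ 2 * p.1.2 ^+ 2))) ^- 2.

Definition unit_square : set (R * R) := `]0, 1[%classic `*` `]0, 1[%classic.
Definition unit_cube : set (R * R * R) := unit_square `*` `]0, 1[%classic.

Lemma measurable_octant_density : measurable_fun [set: R * R * R] octant_density.
Proof.
have m1 : measurable_fun [set: R * R * R] (fun p : R * R * R => p.1.1).
  exact: (measurableT_comp measurable_fst measurable_fst).
have m2 : measurable_fun [set: R * R * R] (fun p : R * R * R => p.1.2).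
  exact: (measurableT_comp measurable_snd measurable_fst).
rewrite /octant_density; apply: measurable_funM.
  by apply: measurable_funM => //; apply: measurable_funB.
apply: measurable_funV; apply: measurable_funX.
have mr : measurable_fun [set: R * R * R] (fun p : R * R * R =>
    p.1.1 ^+ 2 + (1 - p.1.1) ^+ 2 * p.1.2 ^+ 2).
  apply: measurable_funD; first exact: measurable_funX.
  apply: measurable_funM; apply: measurable_funX => //.
  exact: measurable_funB.
apply: measurable_funD; first exact: measurable_funB.
by apply: measurable_funM => //; exact: measurable_funD.
Qed.

Local Open Scope ereal_scope.

(** The library's canonical sigma-finite structure on [mu \x mu] requires
    probability measures, hence this copy. *)
Definition plane_measure : set (measurableTypeR R * measurableTypeR R)%type -> \bar R :=
  mu \x mu.

HB.instance Definition _ := Measure.on plane_measure.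

Let plane_measure_sigma_finite : sigma_finite setT plane_measure.
Proof.
pose I n : set (measurableTypeR R) := `[(- n%:R)%R, n%:R%R]%classic.
exists (fun n => I n `*` I n).
  apply/esym/seteqP; split=> // -[x y] _.
  pose n := (Num.truncn `|x|).+1; pose m := (Num.truncn `|y|).+1.
  have In u k : (`|u| <= k%:R)%R -> I k u.
    by rewrite ler_norml /I /= in_itv.
  exists (maxn n m) => //; split; apply: In => /=.
  - by rewrite (le_trans (ltW (truncnS_gt _)))// ler_nat; exact: leq_maxl.
  - by rewrite (le_trans (ltW (truncnS_gt _)))// ler_nat; exact: leq_maxr.
move=> n; split; first by apply: measurableX; exact: measurable_itv.
have muI : mu (I n) < +oo.
  by rewrite /I /= lebesgue_measure_itv /=; case: ifP => // _; rewrite -?EFinD ltry.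
rewrite /plane_measure product_measure1E; [|exact: measurable_itv..].
by rewrite lte_mul_pinfty// ge0_fin_numE.
Qed.

HB.instance Definition _ := Measure_isSigmaFinite.Build _ _ _ plane_measure
  plane_measure_sigma_finite.

Lemma plane_tonelli (g : (R * R)%type -> \bar R) :
  measurable_fun setT g -> (forall p, 0 <= g p) ->
  \int[plane_measure]_p g p = \int[mu]_x \int[mu]_y g (x, y).
Proof. by move=> mg g0; rewrite /plane_measure fubini_tonelli1. Qed.

Lemma space_tonelli (g : (R * R * R)%type -> \bar R) :
  measurable_fun setT g -> (forall p, 0 <= g p) ->
  \int[(mu \x mu) \x mu]_p g p = \int[mu]_z \int[plane_measure]_q g (q, z).
Proof.
by move=> mg g0; have := fubini_tonelli2 (m1 := plane_measure) (m2 := mu) g mg g0.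
Qed.

Lemma space_tonelli_swap (g : (R * R * R)%type -> \bar R) :
  measurable_fun setT g -> (forall p, 0 <= g p) ->
  \int[(mu \x mu) \x mu]_p g p = \int[plane_measure]_q \int[mu]_z g (q, z).
Proof.
by move=> mg g0; have := fubini_tonelli1 (m1 := plane_measure) (m2 := mu) g mg g0.
Qed.

(** Apply [ge0_even_integral_ge] to z, x and y in turn, with dilations 1, 1 - z and (1 - z) (1 - x).
    Each step also contributes a factor 2, whence the 8. *)
Lemma octant_substitution_le (f K : (R * R * R)%type -> \bar R) :
  measurable_fun [set: (R * R * R)%type] f -> (forall p, 0 <= f p) ->
  measurable_fun [set: (R * R * R)%type] K -> (forall p, 0 <= K p) ->
  (forall x y z, f ((- x)%R, y, z) = f (x, y, z)) ->
  (forall x y z, f (x, (- y)%R, z) = f (x, y, z)) ->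
  (forall x y z, f (x, y, (- z)%R) = f (x, y, z)) ->
  (forall p, ~ unit_cube p -> K p = 0) ->
  (forall x y z, unit_cube (x, y, z) ->
     K (x, y, z) <= (8 * (1 - z) ^+ 2 * (1 - x))%:E *
                    f (((1 - z) * x)%R, ((1 - z) * (1 - x) * y)%R, z)) ->
  \int[(mu \x mu) \x mu]_p K p <= \int[(mu \x mu) \x mu]_p f p.
Proof.
move=> mf f0 mK K0 fx fy fz Kout Kin.
have mGK := measurable_fun_fubini_tonelli_G (m1 := plane_measure) K mK K0.
have mG := measurable_fun_fubini_tonelli_G (m1 := plane_measure) f mf f0.
rewrite space_tonelli// space_tonelli//.
have sec (g : (R * R * R)%type -> \bar R) z :
    measurable_fun [set: (R * R * R)%type] g ->
    measurable_fun [set: (R * R)%type] (fun q => g (q, z)).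
  by move=> mg; exact: (measurableT_comp mg (pair2_measurable z)).
apply: (@ge0_even_integral_ge _ 1%R) => //.
- by move=> z; apply: integral_ge0.
- move=> z; apply: eq_integral => -[x y] _; exact: fz.
- by move=> z; apply: integral_ge0.
- move=> z zI; rewrite integral0_eq// => -[x y] _; apply: Kout.
  by case.
move=> z zI; rewrite mul1r.
have mFK := measurable_fun_fubini_tonelli_F (m2 := mu) _ (sec _ z mK) (fun q => K0 _).
have mF := measurable_fun_fubini_tonelli_F (m2 := mu) _ (sec _ z mf) (fun q => f0 _).
rewrite !plane_tonelli//; [|exact: sec|exact: sec].
rewrite mulr1 -ge0_integralZl//; last by move=> x _; apply: integral_ge0.
move: zI; rewrite /= in_itv /= => /andP[z0 z1].
have z1' : (0 < 1 - z)%R by rewrite subr_gt0.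
apply: (ge0_even_integral_ge z1') => //.
- by apply: emeasurable_funM.
- by move=> x; apply: mule_ge0; [rewrite lee_fin|apply: integral_ge0].
- move=> x; congr (_ * _); apply: eq_integral => y _; exact: fx.
- by move=> x; apply: integral_ge0.
- move=> x xI; rewrite integral0_eq// => y _; apply: Kout.
  by case=> -[].
move=> x; rewrite /= in_itv /= => /andP[x0 x1].
have x1' : (0 < 1 - x)%R by rewrite subr_gt0.
have mfx u : measurable_fun [set: R] (fun y => f (u, y, z)).
  exact: (measurableT_comp (sec _ z mf) (pair1_measurable u)).
rewrite muleA -EFinM -ge0_integralZl//; last 2 first.
- exact: mfx.
- by rewrite lee_fin !mulr_ge0// ltW.
apply: (ge0_even_integral_ge (mulr_gt0 z1' x1')) => //.
- by apply: emeasurable_funM.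
- by move=> y; apply: mule_ge0 => //; rewrite lee_fin !mulr_ge0// ltW.
- by move=> y; rewrite fy.
- exact: (measurableT_comp (sec _ z mK) (pair1_measurable x)).
- by move=> y yI; apply: Kout; case=> -[].
move=> y yI; rewrite muleA -EFinM.
apply: (le_trans (Kin x y z _)).
  by split; [split|]; rewrite /= ?in_itv /= ?x0 ?x1 ?z0 ?z1.
rewrite le_eqVlt; apply/orP; left; apply/eqP; congr (_%:E * _); ring.
Qed.
End OctantSubstitution.

Section OctantIntegral.
Variable R : realType.
Local Notation mu := (@lebesgue_measure R).
Local Open Scope ereal_scope.

(** Under the substitution 1 - |p|^2 acquires a factor 1 - z, whose inverse square cancels the (1 -
    z)^2 of the Jacobian. The image stays in the octahedron because 1 minus its l1 norm is (1 - z)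
    (1 - x) (1 - y). *)
Lemma v8_ge_octant_integral :
  \int[(mu \x mu) \x mu]_(p in @unit_cube R) (octant_density p)%:E <= v8 R.
Proof.
rewrite /v8 /hyperbolic_volume integral_mkcond [leRHS]integral_mkcond.
set phi := fun p : (R * R * R)%type => ((1 - sqnorm3 p) ^- 2)%:E.
have fE p : (phi \_ (@regular_ideal_octahedron R)) p =
    if `[< regular_ideal_octahedron p >] then phi p else 0 by [].
have mcube : measurable (@unit_cube R).
  by apply: measurableX => //; apply: measurableX.
have B0 (x y z : R) : unit_cube (x, y, z) ->
    (0 < (1 - (x ^+ 2 + (1 - x) ^+ 2 * y ^+ 2)) +
   z * (1 + (x ^+ 2 + (1 - x) ^+ 2 * y ^+ 2)))%R.
  move=> [[]] /=; rewrite !in_itv /= => /andP[x0 x1] /andP[y0 y1] /andP[z0 z1].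
  have y2 : (y ^+ 2 <= 1)%R by rewrite expr_le1// ltW.
  have h : ((1 - x) ^+ 2 * y ^+ 2 <= (1 - x) ^+ 2)%R.
    by rewrite ler_piMr// sqr_ge0.
  have h0 : (0 <= (1 - x) ^+ 2 * y ^+ 2)%R by rewrite mulr_ge0 ?sqr_ge0.
  nra.
apply: octant_substitution_le.
- apply/measurable_restrict => //; first exact: measurable_octahedron.
  rewrite setTI; apply: measurable_funTS; apply/measurable_EFinP.
  apply: measurable_funV; apply: measurable_funX; apply: measurable_funB => //.
  exact: measurable_sqnorm3.
- move=> p; rewrite fE; case: ifPn => // _.
  by rewrite lee_fin invr_ge0 exprn_even_ge0.
- apply/measurable_restrict => //.
  by apply: measurable_funTS; apply/measurable_EFinP; exact: measurable_octant_density.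
- move=> [[x y] z]; rewrite patchE; case: ifPn => // /set_mem[[/= p1 _] _].
  move: p1; rewrite /= in_itv/= => /andP[_ /ltW p1].
  rewrite lee_fin mulr_ge0// ?invr_ge0 ?exprn_even_ge0//.
  by rewrite mulr_ge0// subr_ge0.
- by move=> x y z; rewrite !fE /regular_ideal_octahedron /phi /sqnorm3 /= normrN sqrrN.
- by move=> x y z; rewrite !fE /regular_ideal_octahedron /phi /sqnorm3 /= normrN sqrrN.
- by move=> x y z; rewrite !fE /regular_ideal_octahedron /phi /sqnorm3 /= normrN sqrrN.
- by move=> p pc; rewrite patchE memNset.
- move=> x y z cube; rewrite patchE mem_set// fE.
  have {}B0 := B0 _ _ _ cube.
  case: (cube) => -[] /=; rewrite !in_itv /= => /andP[x0 x1] /andP[y0 y1] /andP[z0 z1].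
  have sqE : (1 - sqnorm3 (((1 - z) * x), ((1 - z) * (1 - x) * y), z) =
    (1 - z) * ((1 - (x ^+ 2 + (1 - x) ^+ 2 * y ^+ 2)) +
   z * (1 + (x ^+ 2 + (1 - x) ^+ 2 * y ^+ 2))))%R by rewrite /sqnorm3 /=; ring.
  rewrite asboolT.
    rewrite /phi sqE -EFinM lee_fin le_eqVlt; apply/orP; left; apply/eqP.
    rewrite /octant_density /=; field.
    by rewrite exprMn (gt_eqF B0) subr_eq0 (gt_eqF z1).
  split => /=.
    rewrite !ger0_norm ?mulr_ge0 ?subr_ge0 ?ltW//.
    rewrite -subr_gt0 [ltRHS](_ : _ = (1 - z) * (1 - x) * (1 - y))%R; last by ring.
    by rewrite !mulr_gt0// subr_gt0.
  by rewrite -subr_gt0 sqE mulr_gt0// subr_gt0.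
Qed.

End OctantIntegral.

(** * Moments of (1 + y^2) / 2 *)

Section Moments.
Variable R : realType.
Local Notation mu := (@lebesgue_measure R).

Definition half_poly : {poly R} := 2^-1%:P * (1 + 'X^2).

(** The antiderivative of [half_poly ^+ k] vanishing at 0; the recursion is an
    integration by parts. *)
Fixpoint moment_prim (k : nat) : {poly R} :=
  if k is j.+1 then
    (2 * k + 1)%:R^-1%:P * ('X * half_poly ^+ k + k%:R * moment_prim j)
  else 'X.

Definition moment k : R := (moment_prim k).[1].

(** With W = (1 + y^2) / 2, W' = y and y^2 = 2 W - 1, so the derivative of y W^(k+1) is (2 k + 3)
    W^(k+1) - (k + 1) W^k. *)
Lemma deriv_moment_prim k : (moment_prim k)^`() = half_poly ^+ k.
Proof.
elim: k => [|k IH]; first by rewrite /= derivX expr0.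
have half2 : 2^-1%:P * 2 = 1 :> {poly R}.
  by rewrite -polyC_natr -polyCM mulVf ?pnatr_eq0.
have Wd : half_poly^`() = 'X.
  rewrite /half_poly deriv_mulC derivD derivC add0r derivXn expr1.
  by rewrite -['X *+ 2]mulr_natl mulrA half2 mul1r.
have W2 : 2 * half_poly = 1 + 'X^2.
  by rewrite /half_poly mulrA [2 * _]mulrC half2 mul1r.
have nz : ((2 * k.+1 + 1)%:R : R) != 0 by rewrite pnatr_eq0 addn1.
rewrite /= deriv_mulC derivD derivM derivX mul1r deriv_exp Wd /=.
rewrite -polyC_natr deriv_mulC IH polyC_natr -[X in _ + 'X * X]mulr_natl.
rewrite [X in _ * X](_ : _ = (2 * k.+1 + 1)%:R%:P * half_poly ^+ k.+1).
  by rewrite mulrA -polyCM mulVf// mul1r.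
rewrite polyC_natr natrD natrM exprS.
transitivity (half_poly * half_poly ^+ k + k.+1%:R * half_poly ^+ k * (1 + 'X^2)).
  by ring.
by rewrite -W2; ring.
Qed.

Lemma moment_prim0 k : (moment_prim k).[0] = 0.
Proof.
elim: k => [|k IH] /=; first by rewrite hornerX.
rewrite hornerCM hornerD hornerM hornerX mul0r -polyC_natr hornerCM IH.
by rewrite !(mulr0, addr0).
Qed.

Lemma momentS k : moment k.+1 = (1 + k.+1%:R * moment k) / (2 * k.+1 + 1)%:R.
Proof.
rewrite /moment /= hornerCM hornerD hornerM hornerX mul1r -polyC_natr hornerCM.
rewrite horner_exp /half_poly hornerCM hornerD hornerC hornerXn expr1n.
by rewrite mulVf ?pnatr_eq0// expr1n mulrC.
Qed.

Lemma moment_values :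
  [/\ moment 0 = 1, moment 1 = 2 / 3, moment 2 = 7 / 15 & moment 3 = 12 / 35].
Proof.
have m0 : moment 0 = 1 by rewrite /moment /= hornerX.
have m1 : moment 1 = 2 / 3.
  by rewrite momentS m0 -[(2 * 1 + 1)%N]/3%N; lra.
have m2 : moment 2 = 7 / 15.
  by rewrite momentS m1 -[(2 * 2 + 1)%N]/5%N; lra.
split=> //.
by rewrite momentS m2 -[(2 * 3 + 1)%N]/7%N; lra.
Qed.

(** The recursion preserves the bound because (2 k + 1) (k + 1) >= k (2 k + 3). It starts at 3,
    where 12 / 35 >= 1 / 3; at 2 it fails, as 7 / 15 < 1 / 2. *)
Lemma moment_ge k : (3 <= k)%N -> k%:R^-1 <= moment k.
Proof.
elim: k => // k IH; rewrite ltnS leq_eqVlt => /predU1P[<-|k3].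
  by have [_ _ _ ->] := moment_values; lra.
have k0 : 0 < k%:R :> R by rewrite ltr0n (leq_trans _ k3).
rewrite momentS ler_pdivlMr; last by rewrite ltr0n addn1.
have := IH k3; rewrite -[_^-1 <= _](@ler_pM2l _ k%:R)// divff ?gt_eqF// => h.
rewrite natrD natrM -[k.+1]addn1 natrD.
rewrite mulrC ler_pdivrMr ?ltr_wpDl// ?ltW//.
nra.
Qed.

(** The first three terms add up to 67 / 45, which is 82 / 45 - 1 / 3; from there on [moment_ge]
    bounds the terms by 1 / (k (k + 1)), which telescopes. *)
Lemma sum_moment_ge N : (3 <= N)%N ->
  82 / 45 - N%:R^-1 <= \sum_(k < N) moment k / k.+1%:R.
Proof.
elim: N => // N IH; rewrite ltnS leq_eqVlt => /predU1P[<-|N3].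
  by have [m0 m1 m2 _] := moment_values; rewrite !big_ord_recr big_ord0 /= m0 m1 m2; lra.
rewrite big_ord_recr /=; apply: le_trans (lerD (IH N3) _) => //.
have N0 : 0 < N%:R :> R by rewrite ltr0n (leq_trans _ N3).
have h : N%:R^-1 - N.+1%:R^-1 = N%:R^-1 / N.+1%:R :> R.
  by rewrite -natr1; field; rewrite !gt_eqF// addr_gt0.
rewrite -lerBlDl (_ : _ - _ = N%:R^-1 - N.+1%:R^-1); last by ring.
by rewrite h ler_pM2r ?invr_gt0 ?ltr0n// moment_ge.
Qed.

Lemma integral_poly (p : {poly R}) :
  (\int[mu]_(x in `]0%R, 1%R[) (p^`().[x])%:E = (p.[1] - p.[0])%:E)%E.
Proof.
apply: (@integral_01_FTC2 _ (horner p^`()) (horner p)) => x _.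
by have [] := is_derive_poly p^`() x.
Qed.

End Moments.

(** * Integration of a truncated geometric series *)

Section VolumeLowerBound.
Variable R : realType.
Local Notation mu := (@lebesgue_measure R).

(** Truncated geometric series for 2 / (1 - e) with e = (1 - x) (1 + y^2) / 2, the value of the
    integral of [octant_density] over z. *)
Definition square_poly (N : nat) (x y : R) : R :=
  2 * \sum_(k < N) (1 - x) ^+ k * ((1 + y ^+ 2) / 2) ^+ k.

Lemma square_poly_ge0 N x y : 0 <= x <= 1 -> 0 <= square_poly N x y.
Proof.
move=> /andP[x0 x1]; rewrite mulr_ge0// sumr_ge0// => k _.
by rewrite mulr_ge0// exprn_ge0// ?subr_ge0// divr_ge0// addr_ge0// sqr_ge0.
Qed.

Lemma measurable_square_poly N :
  measurable_fun [set: (R * R)%type] (fun q : R * R => square_poly N q.1 q.2).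
Proof.
apply: measurable_funM => //; apply: measurable_sum => k.
apply: measurable_funM; apply: measurable_funX.
  exact: measurable_funB.
apply: measurable_funM => //; apply: measurable_funD => //.
exact: measurable_funX.
Qed.

Definition inner_poly N (x : R) : {poly R} :=
  2%:P * \sum_(k < N) ((1 - x) ^+ k)%:P * moment_prim R k.

Definition outer_poly N : {poly R} :=
  (- 2)%:P * \sum_(k < N) (moment R k / k.+1%:R)%:P * (1 - 'X) ^+ k.+1.

Lemma deriv_inner_poly N x y : (inner_poly N x)^`().[y] = square_poly N x y.
Proof.
rewrite /inner_poly deriv_mulC hornerCM raddf_sum /= horner_sum; congr (_ * _)%R.
apply: eq_bigr => k _; rewrite deriv_mulC deriv_moment_prim hornerCM horner_exp.
by rewrite /half_poly hornerCM hornerD hornerC hornerXn mulrC [2^-1 * _]mulrC mulrC.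
Qed.

Lemma deriv_outer_poly N x :
  (outer_poly N)^`().[x] = (inner_poly N x).[1] - (inner_poly N x).[0].
Proof.
rewrite /inner_poly !hornerCM !horner_sum -mulrBr -sumrB /outer_poly deriv_mulC.
rewrite hornerCM raddf_sum /=.
rewrite horner_sum mulNr -mulrN -sumrN; congr (_ * _)%R.
apply: eq_bigr => k _; rewrite !hornerCM moment_prim0 mulr0 subr0 -/(moment R k).
rewrite deriv_mulC hornerCM deriv_exp derivB derivC derivX sub0r /=.
rewrite mulN1r hornerMn hornerN horner_exp !hornerD !hornerN hornerC hornerX.
by rewrite -[_ *+ _]mulr_natr; field; rewrite addrC natr1 pnatr_eq0.
Qed.

Lemma outer_poly01 N : (outer_poly N).[1] - (outer_poly N).[0] =
  2 * \sum_(k < N) moment R k / k.+1%:R.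
Proof.
rewrite /outer_poly !hornerCM !horner_sum -mulrBr -sumrB mulNr -mulrN -sumrN.
congr (_ * _)%R; apply: eq_bigr => k _.
rewrite !hornerCM !horner_exp !hornerD !hornerN !hornerC !hornerX.
by rewrite subrr subr0 expr0n expr1n /= mulr0 sub0r mulr1 opprK.
Qed.

Local Open Scope ereal_scope.

Lemma integral_square_poly N :
  \int[mu]_x \int[mu]_y
    ((fun q : (R * R)%type => (square_poly N q.1 q.2)%:E) \_ (@unit_square R)) (x, y) =
  (2 * \sum_(k < N) moment R k / k.+1%:R)%:E.
Proof.
rewrite -outer_poly01 -integral_poly [RHS]integral_mkcond; apply: eq_integral => x _.
rewrite [RHS]patchE; case: ifPn => [xI|xI].
  rewrite deriv_outer_poly -integral_poly [RHS]integral_mkcond.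
  apply: eq_integral => y _.
  rewrite !patchE deriv_inner_poly /=; congr (if _ then _ else _).
  by rewrite /unit_square in_setX xI.
rewrite integral0_eq// => y _; rewrite patchE memNset// => -[/= xI' _].
by move/negP: xI; apply; apply/mem_set.
Qed.

(** The denominator is the square of an affine function [g] of z with [g] 0 = 1 - [rho] and [g] 1 =
    2, so the integral is 4 (1 - x) / (1 - [rho]). *)
Lemma integral_octant_density_z x y : @unit_square R (x, y) ->
  \int[mu]_(z in `]0%R, 1%R[) (octant_density (x, y, z))%:E =
  (2 / (1 - (1 - x) * ((1 + y ^+ 2) / 2)))%:E.
Proof.
move=> [] /=; rewrite !in_itv /= => /andP[x0 x1] /andP[y0 y1].
set rho := (x ^+ 2 + (1 - x) ^+ 2 * y ^+ 2)%R.
have y2 : (y ^+ 2 < 1)%R by rewrite expr_lt1// ltW.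
have A0 : (0 < 1 - rho)%R.
  have h : ((1 - x) ^+ 2 * y ^+ 2 <= (1 - x) ^+ 2)%R.
    by rewrite ler_piMr// ?sqr_ge0// ltW.
  rewrite /rho; nra.
have B0 : (0 < 1 + rho)%R.
  by rewrite ltr_pwDl// /rho addr_ge0 ?sqr_ge0// mulr_ge0 ?sqr_ge0.
pose g (z : R) := (1 - rho + z * (1 + rho))%R.
have g0 z : (0 <= z <= 1)%R -> (0 < g z)%R.
  by move=> /andP[z0 z1]; rewrite /g ltr_pwDl// mulr_ge0// ltW.
have dg z : is_derive z (1 : R)%R g (1 + rho)%R.
  rewrite (_ : g = cst (1 - rho)%R + (1 + rho)%R \*: id)%R; last first.
    by apply/funext => u; rewrite /g /= mulrC.
  by apply: is_derive_eq; rewrite add0r /GRing.scale /= mulr1.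
pose F (z : R) := (- (8 * (1 - x) / (1 + rho)) * (g z)^-1)%R.
transitivity (F 1 - F 0)%:E; last first.
  congr (_%:E); rewrite /F /g mul1r mul0r addr0.
  rewrite (_ : (1 - rho + (1 + rho))%R = 2%R); last by ring.
  have x1' : (0 < 1 - x)%R by rewrite subr_gt0.
  have D0 : (0 < 2 - (1 - x) * (1 + y ^+ 2))%R by nra.
  (* The factor 1 - x of 1 - [rho] cancels the one left by the Jacobian. *)
  have AE : (1 - rho = (1 - x) * (2 - (1 - x) * (1 + y ^+ 2)))%R by rewrite /rho; ring.
  rewrite AE; have := B0; have -> : (1 + rho = 2 - (1 - rho))%R by ring.
  rewrite AE => B0'; move: D0 B0'; set D := (2 - _)%R => D0 B0'.
  rewrite (_ : (1 - (1 - x) * ((1 + y ^+ 2) / 2))%R = D / 2)%R; last by rewrite /D; field.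
  by field; rewrite !lt0r_neq0.
apply: integral_01_FTC2.
- move=> z z01; rewrite /octant_density /= -/rho -/(g z).
  have gz := g0 _ z01.
  have dV := is_deriveV (lt0r_neq0 gz) (dg z).
  apply: (is_derive_eq (is_deriveZ (- (8 * (1 - x) / (1 + rho)))%R dV)).
  rewrite /GRing.scale /=.
  by field; rewrite !lt0r_neq0.
- move=> z z01; rewrite /octant_density /= -/rho -/(g z).
  have gz := g0 _ z01.
  rewrite (_ : (fun z => _) = (8 * (1 - x))%R \*: (fun z => (g z)^-1 ^+ 2)%R); last first.
    by apply/funext => u; rewrite /= exprVn.
  have dV := is_deriveV (lt0r_neq0 gz) (dg z).
  by have [] := is_deriveZ (8 * (1 - x))%R (is_deriveX 2 dV).
Qed.

Lemma v8_ge_moments N : (2 * \sum_(k < N) moment R k / k.+1%:R)%:E <= v8 R.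
Proof.
apply: le_trans (v8_ge_octant_integral R).
set K := (fun q : (R * R)%type => (square_poly N q.1 q.2)%:E) \_ (@unit_square R).
have msquare : measurable (@unit_square R) by apply: measurableX.
have mcube : measurable (@unit_cube R) by apply: measurableX.
have mK : measurable_fun [set: (R * R)%type] K.
  apply/measurable_restrict => //; apply: measurable_funTS; apply/measurable_EFinP.
  exact: measurable_square_poly.
have K0 q : 0 <= K q.
  rewrite /K patchE; case: ifPn => // /set_mem[+ _]; rewrite /= in_itv /=.
  by move=> /andP[x0 x1]; rewrite lee_fin square_poly_ge0// !ltW.
rewrite -integral_square_poly -(plane_tonelli mK K0) [leRHS]integral_mkcond.
set f := _ \_ (@unit_cube R).
have mf : measurable_fun [set: (R * R * R)%type] f.
  apply/measurable_restrict => //; apply: measurable_funTS; apply/measurable_EFinP.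
  exact: measurable_octant_density.
have f0 p : 0 <= f p.
  rewrite /f patchE; case: ifPn => // /set_mem[[/= p1 _] _].
  move: p1; rewrite /= in_itv/= => /andP[_ /ltW p1].
  rewrite lee_fin mulr_ge0// ?invr_ge0 ?exprn_even_ge0//.
  by rewrite mulr_ge0// subr_ge0.
rewrite space_tonelli_swap//; apply: ge0_le_integral => //.
- exact: (measurable_fun_fubini_tonelli_F (m2 := mu) f mf f0).
- move=> [x y] _; rewrite /K patchE; case: ifPn => [/set_mem xy|_]; last first.
    by apply: integral_ge0.
  have -> : \int[mu]_z f (x, y, z) =
      \int[mu]_(z in `]0%R, 1%R[) (octant_density (x, y, z))%:E.
    rewrite [RHS]integral_mkcond; apply: eq_integral => z _.
    rewrite /f !patchE /=; congr (if _ then _ else _).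
    by rewrite /unit_cube in_setX mem_set.
  rewrite integral_octant_density_z// lee_fin /square_poly /=.
  case: xy; rewrite /= !in_itv /= => /andP[x0 x1] /andP[y0 y1].
  have y2 : (y ^+ 2 < 1)%R by rewrite expr_lt1// ltW.
  have y2' : (0 <= y ^+ 2)%R by rewrite sqr_ge0.
  under eq_bigr do rewrite -exprMn.
  set e := ((1 - x) * _)%R.
  have e1 : (e < 1)%R by rewrite /e; nra.
  have e0 : (0 <= e)%R by rewrite /e; nra.
  (* The partial sum lies below 1 / (1 - e), since its product with 1 - e is 1 - e^N. *)
  rewrite ler_pM2l// -[leRHS]mul1r ler_pdivlMr ?subr_gt0// mulrC.
  by rewrite -opprB mulNr -subrX1 opprB lerBlDr lerDl exprn_ge0.
Qed.

Lemma v8_ge : (3635 / 1000)%:E <= v8 R.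
Proof.
(* The resulting bound 2 (82 / 45 - 1 / 300) is about 3.638. *)
apply: le_trans (v8_ge_moments 300); rewrite lee_fin.
have := @sum_moment_ge R 300 isT; lra.
Qed.

End VolumeLowerBound.

(** * Products of sines *)

Section Trigonometry.
Variable R : realType.
Implicit Types (x y h : R) (n : nat).

(** By the mean value theorem. The Taylor inequalities below follow from one another by this lemma,
    each being the derivative of the next. *)
Lemma ge0_is_derive (f df : R -> R) : f 0 = 0 ->
  (forall x : R, is_derive x (1 : R) f (df x)) ->
  (forall x, 0 <= x -> 0 <= df x) -> forall x, 0 <= x -> 0 <= f x.
Proof.
move=> f0 fdf df0 x; rewrite le_eqVlt => /predU1P[<-|x0]; first by rewrite f0.
have [|c] := MVT x0 (fun z _ => fdf z).
  by apply: derivable_within_continuous => z _; have [] := fdf z.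
rewrite in_itv /= f0 !subr0 => /andP[c0 _] ->.
by rewrite mulr_ge0 ?df0// ltW.
Qed.

Lemma sin_le x : 0 <= x -> sin x <= x.
Proof.
move=> x0; rewrite -subr_ge0; move: x x0; apply: (@ge0_is_derive (id - sin) (fun x => 1 - cos x)).
- by rewrite !fctE sin0 subr0.
- by move=> z _; rewrite subr_ge0 cos_le1.
Qed.

Lemma cos_ge x : 1 - x ^+ 2 / 2 <= cos x.
Proof.
wlog x0 : x / 0 <= x => [H|].
  have [/H//|/ltW x0] := leP 0 x.
  by rewrite -cosN -sqrrN H// oppr_ge0.
rewrite -subr_ge0; move: x x0.
apply: (@ge0_is_derive (fun x => cos x - (1 - x ^+ 2 / 2)) (fun x => x - sin x)).
- by rewrite cos0 expr0n /= mul0r subr0 subrr.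
- move=> z.
  rewrite (_ : (fun _ => _) = cos - (cst 1 - 2^-1 \*: (id ^+ 2))); last first.
    by apply/funext => u /=; rewrite !fctE mulrC.
  apply: is_derive_eq; rewrite /GRing.scale /=; by field.
- by move=> z z0; rewrite subr_ge0 sin_le.
Qed.

Lemma sin_ge_cubic x : 0 <= x -> x - x ^+ 3 / 6 <= sin x.
Proof.
move=> x0; rewrite -subr_ge0; move: x x0.
apply: (@ge0_is_derive (fun x => sin x - (x - x ^+ 3 / 6))
  (fun x => cos x - (1 - x ^+ 2 / 2))).
- by rewrite sin0 expr0n /= mul0r !subr0.
- move=> z.
  rewrite (_ : (fun _ => _) = sin - (id - 6^-1 \*: (id ^+ 3))); last first.
    by apply/funext => u /=; rewrite !fctE mulrC.
  apply: is_derive_eq; rewrite /GRing.scale /=; by field.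
- by move=> z _; rewrite subr_ge0 cos_ge.
Qed.

(** The triple angle formula at pi / 6 gives 3 s - 4 s^3 = 1, that is (s + 1) (2 s - 1)^2 = 0, and s
    is positive. *)
Lemma sin_pi6 : sin (pi / 6) = 2^-1 :> R.
Proof.
have s0 : 0 < sin (pi / 6) :> R.
  by have := pi_gt0 R => p0; apply: sin_gt0_pi; lra.
have : sin (pi / 6 + (pi / 6) *+ 2) = 1 :> R.
  by rewrite [X in sin X](_ : _ = pi / 2) ?sin_pihalf//; field.
rewrite sinD cos_mulr2n sin_mulr2n.
have := cos2Dsin2 (pi / 6 : R).
set s := sin _ in s0 *; set c := cos _ => cs e.
have : (s + 1) * (2 * s - 1) ^+ 2 = 0.
  have {}e : s * (c ^+ 2 *+ 2 - 1) + c ^+ 2 * s *+ 2 = 1 by rewrite -[RHS]e; ring.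
  have c2 : c ^+ 2 = 1 - s ^+ 2 by rewrite -cs; ring.
  rewrite c2 in e.
  transitivity (1 - (s * ((1 - s ^+ 2) *+ 2 - 1) + (1 - s ^+ 2) * s *+ 2)); first by ring.
  by rewrite e subrr.
move/eqP; rewrite mulf_eq0 sqrf_eq0 => /orP[] /eqP; lra.
Qed.

Lemma pi_ge3 : 3 <= pi :> R.
Proof.
have := @sin_le (pi / 6) (divr_ge0 (pi_ge0 R) (ler0n R 6)); rewrite sin_pi6; lra.
Qed.

(** Otherwise pi / 6 > 0.55, while the cubic Taylor bound gives sin 0.55 > 1 / 2 = sin (pi / 6). *)
Lemma pi_le : pi <= 33 / 10 :> R.
Proof.
rewrite leNgt; apply/negP => pi33.
have := @sin_ge_cubic (55 / 100).
have : sin (55 / 100) <= sin (pi / 6) :> R.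
  have pi0 := pi_ge0 R.
  by rewrite ltW// ltr_sin ?in_itv /=; lra.
rewrite sin_pi6; lra.
Qed.

Lemma expRN_le x : 0 <= x -> expR (- x) <= 1 - x + x ^+ 2 / 2.
Proof.
move=> x0; rewrite -subr_ge0; move: x x0.
apply: (@ge0_is_derive (fun x => 1 - x + x ^+ 2 / 2 - expR (- x))
  (fun x => expR (- x) - (1 - x))).
- by rewrite oppr0 expR0; lra.
- move=> z.
  rewrite (_ : (fun _ => _) = cst 1 - id + 2^-1 \*: (id ^+ 2) - (expR \o -%R)); last first.
    by apply/funext => u; rewrite !fctE [u ^+ 2 / 2]mulrC.
  apply: is_derive_eq; rewrite /GRing.scale /=; by field.
- by move=> z _; rewrite subr_ge0 expR_ge1Dx.
Qed.

Lemma expRN_ge x : 0 <= x -> 1 - x + x ^+ 2 / 2 - x ^+ 3 / 6 <= expR (- x).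
Proof.
move=> x0; rewrite -subr_ge0; move: x x0.
apply: (@ge0_is_derive (fun x => expR (- x) - (1 - x + x ^+ 2 / 2 - x ^+ 3 / 6))
  (fun x => 1 - x + x ^+ 2 / 2 - expR (- x))).
- by rewrite oppr0 expR0; lra.
- move=> z.
  rewrite (_ : (fun _ => _) = (expR \o -%R) -
      (cst 1 - id + 2^-1 \*: (id ^+ 2) - 6^-1 \*: (id ^+ 3))); last first.
    by apply/funext => u; rewrite !fctE [u ^+ 2 / 2]mulrC [u ^+ 3 / 6]mulrC.
  apply: is_derive_eq; rewrite /GRing.scale /=; by field.
- by move=> z z0; rewrite subr_ge0 expRN_le.
Qed.

Lemma expR_fifth_le : expR (1 / 5) <= 11 / 9 :> R.
Proof.
have e0 := expR_gt0 (1 / 5 : R).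
have : 9 / 11 <= expR (- (1 / 5)) :> R.
  have := @expRN_ge (1 / 5); lra.
rewrite expRN.
by rewrite -[leRHS]mul1r ler_pdivlMr//; lra.
Qed.

(** A discrete form of x cos x <= sin x, by induction with the addition formulas. *)
Lemma sin_mulnS_le h n : 0 <= h -> n%:R * h <= pi / 2 -> h <= pi / 2 ->
  n%:R * cos (n%:R * h) * sin h <= sin (n%:R * h).
Proof.
move=> h0 + h2; have p0 := pi_gt0 R.
have sh : 0 <= sin h by apply: sin_ge0_pi; lra.
have ch : 0 <= cos h <= 1.
  by rewrite cos_le1 andbT cos_ge0_pihalf//; lra.
elim: n => [|n IH]; first by rewrite !mul0r sin0.
rewrite -natr1 mulrDl mul1r => nh.
have nh0 : 0 <= n%:R * h by rewrite mulr_ge0.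
have {}IH : n%:R * cos (n%:R * h) * sin h <= sin (n%:R * h) by apply: IH; lra.
have sn : 0 <= sin (n%:R * h) by apply: sin_ge0_pi; lra.
have cn : 0 <= cos (n%:R * h) by rewrite cos_ge0_pihalf//; lra.
rewrite sinD cosD.
set s := sin (n%:R * h) in sn IH *; set c := cos (n%:R * h) in cn IH *.
set u := sin h in sh IH *; set v := cos h in ch *.
case/andP: ch => v0 v1.
have h1 : n%:R * c * u * v <= s * v by rewrite ler_wpM2r.
have h4 : c * u * v <= c * u by rewrite ler_piMr// mulr_ge0.
have h3 : 0 <= (n%:R + 1) * (s * u * u) by rewrite !mulr_ge0// addr_ge0.
have -> : (n%:R + 1) * (c * v - s * u) * u =
  n%:R * c * u * v + c * u * v - (n%:R + 1) * (s * u * u) by ring.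
lra.
Qed.

End Trigonometry.

(** * Sums of logarithms of sines *)

Section LogSine.
Variable R : realType.
Implicit Types (x y h t : R) (n : nat).

(** Positive only near 0 and [pi], where [2 * sin t < expR (1 / 5)]. *)
Definition log_sine t : R := 1 / 5 - ln (2 * sin t).

Lemma log_sine_le t u : 0 < t -> t <= u -> u <= pi / 2 -> log_sine u <= log_sine t.
Proof.
move=> t0 tu u2; have p0 := pi_gt0 R.
have st : 0 < sin t by apply: sin_gt0_pi; lra.
rewrite lerD2l lerN2 ler_ln ?posrE ?mulr_gt0//; last by apply: sin_gt0_pi; lra.
rewrite ler_pM2l//; move: tu; rewrite le_eqVlt => /predU1P[->//|tu].
by rewrite ltW// ltr_sin ?in_itv /=; lra.
Qed.

(** A discrete form of the fact that sin x / x decreases: expand the left sine and apply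
    [sin_mulnS_le] to the term with cos (n h) sin h. *)
Lemma sin_mulS_le h n : 0 < h -> n.+1%:R * h <= pi / 2 ->
  n%:R * sin (n.+1%:R * h) <= n.+1%:R * sin (n%:R * h).
Proof.
move=> h0; rewrite -natr1 mulrDl mul1r => nh.
have nh0 : 0 <= n%:R * h by rewrite mulr_ge0// ltW.
have p0 := pi_gt0 R.
have s0 : 0 <= sin (n%:R * h) by apply: sin_ge0_pi; lra.
have := @sin_mulnS_le R h n; rewrite sinD => H.
have {}H := H (ltW h0) _ _; have {H} H : n%:R * cos (n%:R * h) * sin h <= sin (n%:R * h).
  by apply: H; lra.
have : n%:R * (sin (n%:R * h) * cos h) <= n%:R * sin (n%:R * h).
  by rewrite ler_wpM2l// ler_piMr// cos_le1.
lra.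
Qed.

(** Equivalently [prod_(i <= n) sin (i h) >= (sin (n h) / e) ^ n]; the induction
    step is [(1 + 1 / n) ^ n <= e]. *)
Lemma sum_log_sine_le h n : 0 < h -> (0 < n)%N -> n%:R * h <= pi / 2 ->
  \sum_(1 <= i < n.+1) log_sine (i%:R * h) <= n%:R * (log_sine (n%:R * h) + 1).
Proof.
move=> h0; have p0 := pi_gt0 R.
elim: n => // -[|n] IH _.
  by rewrite big_nat1 !mul1r lerDl.
move=> nh.
have n1h : 0 < n.+1%:R * h by rewrite mulr_gt0.
have nh' : n.+1%:R * h < n.+2%:R * h by rewrite ltr_pM2r// ltr_nat.
have s1 : 0 < sin (n.+1%:R * h) by apply: sin_gt0_pi; lra.
have s2 : 0 < sin (n.+2%:R * h) by apply: sin_gt0_pi; lra.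
rewrite big_nat_recr//=; apply: le_trans (lerD (IH isT _) (lexx _)) _; first lra.
have := sin_mulS_le h0 nh.
set a := sin (n.+1%:R * h) in s1 *; set b := sin (n.+2%:R * h) in s2 *.
move=> ab; rewrite /log_sine -/a -/b.
have ln_le : ln (2 * b) - ln (2 * a) <= n.+1%:R^-1.
  rewrite -ln_div ?posrE ?mulr_gt0//.
  have -> : 2 * b / (2 * a) = b / a by field; rewrite gt_eqF.
  have : ln (b / a) <= ln (1 + n.+1%:R^-1).
    rewrite ler_ln ?posrE ?divr_gt0 ?addr_gt0 ?invr_gt0//.
    rewrite ler_pdivrMr//.
    rewrite -(@ler_pM2l _ n.+1%:R)// mulrA mulrDr mulr1 mulfV ?pnatr_eq0//.
    by rewrite natr1.
  move=> /le_trans; apply.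
  by apply: le_ln1Dx; rewrite (@lt_le_trans _ _ 0)// ?invr_ge0// oppr_lt0.
have {}ln_le : n.+1%:R * (ln (2 * b) - ln (2 * a)) <= 1.
  by rewrite -[leRHS](@mulfV _ n.+1%:R) ?pnatr_eq0// ler_pM2l.
rewrite -[n.+2%:R]natr1.
set N := n.+1%:R in ln_le *; lra.
Qed.

(** By [sum_log_sine_le] it is enough that x ([log_sine] x + 1) <= 33 / 50 for x = n h. Where
    [log_sine] x is nonnegative, sin x <= 11 / 18 forces x <= 33 / 50; then ln u <= u - 1 with u =
    exp (1 / 5) / (2 sin x) reduces the claim to u <= (33 / 50) / x. *)
Lemma sum_log_sine_le_inv h n : 0 < h -> n%:R * h <= pi / 2 ->
  0 <= log_sine (n%:R * h) ->
  \sum_(1 <= i < n.+1) log_sine (i%:R * h) <= (33 / 50) / h.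
Proof.
case: n => [|n] h0 nh; first by rewrite big_geq// divr_ge0// ltW.
move=> f0; apply: le_trans (sum_log_sine_le h0 _ nh) _ => //.
have p0 := pi_gt0 R; have p3 := pi_ge3 R.
set x := n.+1%:R * h in nh f0 *.
have x0 : 0 < x by rewrite mulr_gt0.
have s0 : 0 < sin x by apply: sin_gt0_pi; lra.
have e5 := expR_fifth_le R.
have sle : 2 * sin x <= expR (1 / 5).
  by rewrite -ler_ln ?posrE ?mulr_gt0 ?expR_gt0// expRK -subr_ge0.
have xle : x <= 33 / 50.
  rewrite leNgt; apply/negP => xgt.
  have : sin (33 / 50) < sin x by rewrite ltr_sin ?in_itv /=; lra.
  have := @sin_ge_cubic R (33 / 50); lra.
(* The ratio 25 / 27 is chosen so that (11 / 9) (27 / 25) / 2 = 33 / 50. *)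
have sx : x * (25 / 27) <= sin x.
  have := @sin_ge_cubic R x (ltW x0).
  have : x ^+ 2 <= (33 / 50) ^+ 2 by rewrite lerXn2r// ?nnegrE; lra.
  move=> x2; apply: le_trans; nra.
have fle : log_sine x + 1 <= (33 / 50) / x.
  rewrite /log_sine -[1 / 5]expRK -ln_div ?posrE ?expR_gt0 ?mulr_gt0//.
  have : ln (expR (1 / 5) / (2 * sin x)) <= ln (1 + ((33 / 50) / x - 1)).
    rewrite subrKC ler_ln ?posrE ?divr_gt0 ?expR_gt0 ?mulr_gt0//.
    rewrite ler_pdivrMr ?mulr_gt0// mulrAC ler_pdivlMr//.
    have e0 := expR_gt0 (1 / 5 : R).
    nra.
  move=> /le_trans h1; rewrite -lerBrDr; apply: h1.
  apply: le_ln1Dx; rewrite ltrBDr addNr divr_gt0//; lra.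
rewrite (_ : (33 / 50) / h = n.+1%:R * ((33 / 50) / x)); first by rewrite ler_pM2l.
rewrite /x; field; rewrite !gt_eqF//.
Qed.

End LogSine.

(** * The numbers {i} and their product *)

Section Curly.
Variable R : realType.
Variable N : nat.
Hypothesis N0 : (0 < N)%N.
Local Notation r := (2 * N + 1)%N.
Local Notation h := (2 * pi / r%:R : R).

Let r0 : (0 < r%:R :> R).
Proof. by rewrite ltr0n addn1. Qed.

Let rE : r%:R = 2 * N%:R + 1 :> R.
Proof. by rewrite natrD natrM. Qed.

Lemma curlyE_low i : curly R r i = 2 * sin (i%:R * h).
Proof. by rewrite /curly natrM; congr (_ * sin _); ring. Qed.

(** Since N h = pi - h / 2, an index above N is written N + j; its sine is then, up to sign, taken
    at a half-odd multiple of h. *)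
Lemma curlyE_high j : curly R r (N + j) = - (2 * sin (j%:R * h - h / 2)).
Proof.
rewrite curlyE_low -mulrN -sinDpi; congr (_ * sin _); rewrite natrD.
by rewrite rE; field; rewrite -rE gt_eqF.
Qed.

Lemma sin_low_gt0 i : (0 < i <= N)%N -> 0 < sin (i%:R * h).
Proof.
move=> /andP[i0 iN]; have p0 := pi_gt0 R.
have i0' : 0 < i%:R :> R by rewrite ltr0n.
have iN' : i%:R <= N%:R :> R by rewrite ler_nat.
apply: sin_gt0_pi; rewrite !mulr_gt0 ?invr_gt0//= mulrA ltr_pdivrMr// rE.
nra.
Qed.

Lemma sin_high_gt0 j : (0 < j <= N)%N -> 0 < sin (j%:R * h - h / 2).
Proof.
move=> /andP[j0 jN]; have p0 := pi_gt0 R.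
have j0' : 1 <= j%:R :> R by rewrite ler1n.
have jN' : j%:R <= N%:R :> R by rewrite ler_nat.
have -> : j%:R * h - h / 2 = (2 * j%:R - 1) * pi / r%:R by field; rewrite gt_eqF.
apply: sin_gt0_pi; apply/andP; split.
  by rewrite divr_gt0// mulr_gt0//; lra.
rewrite ltr_pdivrMr// rE; nra.
Qed.

Lemma curly_neq0 i : (0 < i < r)%N -> curly R r i != 0.
Proof.
move=> /andP[i0 ir]; have [iN|Ni] := leqP i N.
  by rewrite curlyE_low mulf_neq0// gt_eqF// sin_low_gt0 ?i0.
rewrite -(subnKC (ltnW Ni)) curlyE_high oppr_eq0 mulf_neq0// gt_eqF//.
by rewrite sin_high_gt0// subn_gt0 Ni /=; lia.
Qed.

Lemma curly_r : curly R r r = 0.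
Proof.
rewrite curlyE_low [X in sin X](_ : _ = pi *+ 2) ?sin2pi ?mulr0//.
by rewrite -[pi *+ 2]mulr_natl; field; rewrite gt_eqF.
Qed.

Lemma curly_reflect i : (i <= r)%N -> curly R r (r - i) = - curly R r i.
Proof.
move=> ir; rewrite !curlyE_low natrB// -mulrN -sinN; congr (_ * _).
rewrite -[RHS]sinD2pi; congr sin.
by rewrite -[pi *+ 2]mulr_natl; field; rewrite gt_eqF.
Qed.

Local Notation C := (complex R).
Local Open Scope complex_scope.

Let zeta_pow k : (cos (2 * h) +i* sin (2 * h)) ^+ k =
  cos (k%:R * (2 * h)) +i* sin (k%:R * (2 * h)) :> C.
Proof.
elim: k => [|k IH]; first by rewrite expr0 mul0r cos0 sin0.
rewrite exprS IH -[k.+1%:R]natr1 [(k%:R + 1) * _]mulrDl mul1r.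
rewrite [k%:R * (2 * h) + _]addrC cosD sinD.
by congr (_ +i* _); rewrite addrC.
Qed.

Let normc_1B k : ComplexField.Normc.normc (1 - (cos (2 * h) +i* sin (2 * h)) ^+ k : C) =
  `|curly R r k|.
Proof.
rewrite zeta_pow /ComplexField.Normc.normc /=.
have -> : k%:R * (2 * h) = (k%:R * h) *+ 2 by rewrite -[RHS]mulr_natl; ring.
rewrite cos_mulr2n sin_mulr2n cos2sin2 curlyE_low.
rewrite -sqrtr_sqr; congr Num.sqrt.
have := cos2Dsin2 (k%:R * h); set c := cos _; set s := sin _ => cs.
have c2 : c ^+ 2 = 1 - s ^+ 2 by rewrite -[1]cs; ring.
transitivity (4 * s ^+ 2 * (c ^+ 2 + s ^+ 2)); first by rewrite sub0r; ring.
by rewrite cs; ring.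
Qed.

(** With z = exp (2 i h), [normc_1B] identifies |{k}| with |1 - z^k|. Evaluating (X^r - 1) / (X -
    1), the product of the X - z^k, at 1 gives r. *)
Lemma prod_curly : \prod_(1 <= i < r) `|curly R r i| = r%:R.
Proof.
pose z : C := cos (2 * h) +i* sin (2 * h).
have zr : z ^+ r = 1.
  rewrite zeta_pow (_ : r%:R * _ = pi *+ 2 + pi *+ 2).
    by rewrite cosD2pi cos2pi sinD2pi sin2pi.
  by rewrite -[pi *+ 2]mulr_natl; field; rewrite gt_eqF.
(* An order m of z below r would make {m} vanish. *)
have zprim : (r.-primitive_root z)%R.
  have [m mprim mr] := prim_order_exists (n := r) ltac:(by rewrite addn1) zr.
  have m0 := prim_order_gt0 mprim.
  have [<-//|mr'] := eqVneq m r.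
  have ltm : (m < r)%N by rewrite ltn_neqAle mr' dvdn_leq// addn1.
  have := normc_1B m; rewrite (prim_expr_order mprim) subrr ComplexField.Normc.normc0.
  move=> /esym/eqP; rewrite normr_eq0 => cm.
  by have := curly_neq0 (introT andP (conj m0 ltm)); rewrite cm.
have X1 : 'X - 1%:P != 0 :> {poly C} by rewrite polyXsubC_eq0.
have := factor_Xn_sub_1 zprim.
rewrite big_ltn; last by rewrite addn1.
rewrite expr0 subrX1 => /(mulfI X1) /(congr1 (horner ^~ 1)).
rewrite horner_prod horner_sum => H.
have {}H : \prod_(1 <= i < r) (1 - z ^+ i) = r%:R :> C.
  transitivity (\prod_(1 <= i < r) ('X - (z ^+ i)%:P).[1]).
    by apply: eq_bigr => i _; rewrite !hornerE.
  rewrite H (eq_bigr (fun=> 1)) ?sumr_const ?card_ord// => i _.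
  by rewrite hornerXn expr1n.
have := congr1 (@ComplexField.Normc.normc R) H.
rewrite (big_morph _ (@ComplexField.Normc.normcM R) (ComplexField.Normc.normc1 R)).
rewrite (eq_bigr (fun i => `|curly R r i|)) => [e|i _]; last exact: normc_1B.
by rewrite [LHS]e normcMn ComplexField.Normc.normc1.
Qed.

End Curly.

(** A nonpositive last term may be dropped; after a positive one, either the bound is known or all
    later terms are nonnegative and the full sum dominates. This suits [log_sine], which is positive
    only near both ends. *)
Lemma unimodal_partial_sum (R : realDomainType) (u : nat -> R) (N : nat) (A : R) :
  0 <= A -> \sum_(1 <= i < N.+1) u i <= A ->
  (forall n, (0 < n <= N)%N -> 0 < u n ->
     \sum_(1 <= i < n.+1) u i <= A \/ forall i, (n <= i <= N)%N -> 0 <= u i) ->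
  forall n, (n <= N)%N -> \sum_(1 <= i < n.+1) u i <= A.
Proof.
move=> A0 AN H; elim=> [|n IH] nN; first by rewrite big_geq.
have [un|un] := leP (u n.+1) 0.
  rewrite big_nat_recr//=; apply: le_trans (IH (ltnW nN)).
  by rewrite gerDl.
have [//|ge0] := H n.+1 nN un.
apply: le_trans AN; rewrite (@big_cat_nat _ _ _ n.+2 1 N.+1)//= lerDl.
rewrite big_nat_cond sumr_ge0// => i; rewrite andbT ltnS => /andP[ni iN].
by apply: ge0; rewrite iN (ltnW ni).
Qed.

Section LogSineReflect.
Variable R : realType.

Lemma log_sine_reflect (t : R) : log_sine (pi - t) = log_sine t.
Proof.
by rewrite /log_sine sinB sinpi cospi mul0r mulN1r opprK add0r.
Qed.

Lemma log_sine_ge (t u : R) : pi / 2 <= t -> t <= u -> u < pi ->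
  log_sine t <= log_sine u.
Proof.
move=> t2 tu u1; rewrite -(log_sine_reflect t) -(log_sine_reflect u).
have p0 := pi_gt0 R.
by apply: log_sine_le; lra.
Qed.

End LogSineReflect.

(** * Lower bounds on quantum factorials *)

Section QuantumFactorial.
Variable R : realType.
Variable N : nat.
Hypothesis N0 : (0 < N)%N.
Local Notation r := (2 * N + 1)%N.
Local Notation h := (2 * pi / r%:R : R).

Let r0 : (0 < r%:R :> R).
Proof. by rewrite ltr0n addn1. Qed.

Let rE : r%:R = 2 * N%:R + 1 :> R.
Proof. by rewrite natrD natrM. Qed.

Lemma norm_curly_fact n :
  `|curly_fact R r n| = \prod_(1 <= i < n.+1) `|curly R r i|.
Proof. by rewrite /curly_fact normr_prod. Qed.

Lemma norm_curly_fact_gt0 n : (n < r)%N -> 0 < `|curly_fact R r n|.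
Proof.
move=> nr; rewrite norm_curly_fact big_nat_cond prodr_gt0// => i.
rewrite andbT => /andP[i0 ni]; rewrite normr_gt0 curly_neq0//.
by rewrite i0 (leq_trans ni nr).
Qed.

(** The reflection i -> r - i turns the second factorial into the product of the {i} with n < i < r,
    which completes the first one to [prod_curly]. *)
Lemma curly_fact_reflect n : (n < r)%N ->
  `|curly_fact R r n| * `|curly_fact R r (r.-1 - n)| = r%:R.
Proof.
move=> nr; rewrite !norm_curly_fact -(prod_curly R N0).
rewrite [RHS](@big_cat_nat _ _ _ n.+1)//=; congr (_ * _).
rewrite -[n.+1]/(1 + n)%N big_addn [RHS]big_nat_rev /=.
have -> : (r.-1 - n).+1 = (r - n)%N by lia.
rewrite big_nat_cond [RHS]big_nat_cond; apply: eq_bigr => i; rewrite andbT => ir.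
rewrite (_ : (1 + (r - n) - i.+1 + n)%N = (r - i)%N); last by lia.
by rewrite curly_reflect ?normrN//; lia.
Qed.

Lemma ln_curly_fact n : (n < r)%N ->
  ln `|curly_fact R r n| = \sum_(1 <= i < n.+1) ln `|curly R r i|.
Proof.
elim: n => [|n IH] nr; first by rewrite /curly_fact !big_geq// normr1 ln1.
rewrite big_nat_recr//= -IH ?(ltnW nr)// -lnM ?posrE ?norm_curly_fact_gt0 ?(ltnW nr)//.
  by rewrite -normrM /curly_fact big_nat_recr.
by rewrite normr_gt0 curly_neq0.
Qed.

Lemma ln_curly_fact_half : ln `|curly_fact R r N| = ln r%:R / 2.
Proof.
have NR : (N < r)%N by lia.
have := curly_fact_reflect NR; rewrite (_ : (r.-1 - N = N)%N); last by lia.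
move=> <-; rewrite lnM ?posrE ?norm_curly_fact_gt0//; lra.
Qed.

Lemma log_sine_low i : (0 < i <= N)%N ->
  log_sine (i%:R * h) = 1 / 5 - ln `|curly R r i|.
Proof.
by move=> iN; rewrite curlyE_low gtr0_norm// mulr_gt0// sin_low_gt0.
Qed.

Lemma log_sine_high j : (0 < j <= N)%N ->
  log_sine (j%:R * h - h / 2) = 1 / 5 - ln `|curly R r (N + j)|.
Proof.
by move=> iN; rewrite curlyE_high// normrN gtr0_norm// mulr_gt0// sin_high_gt0.
Qed.

(** The smallest half-odd argument is pi / r, and 2 sin (pi / r) >= 1 / r; this one term accounts
    for the ln r + 1 / 5 in the bound [A] below. *)
Lemma log_sine_first : log_sine (h / 2) <= 1 / 5 + ln r%:R.
Proof.
rewrite /log_sine lerD2l lerNl -lnV ?posrE//.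
have r3 : 3 <= r%:R :> R by rewrite rE; have : 1 <= N%:R :> R; [rewrite ler1n|lra].
have p3 := pi_ge3 R; have p4 := pi_le R.
have -> : h / 2 = pi / r%:R by field; rewrite gt_eqF.
set x := pi / r%:R.
have x0 : 0 <= x by rewrite divr_ge0//; lra.
have x1 : x <= 11 / 10 by rewrite ler_pdivrMr//; lra.
have rx : r%:R^-1 <= x / 3.
  by rewrite /x mulrAC -[leLHS]mul1r ler_pM2r ?invr_gt0//; lra.
have s := @sin_ge_cubic R x x0.
have x2 : x ^+ 3 <= x * 2.
  by rewrite exprS ler_wpM2l//; nra.
have ri : 0 < r%:R^-1 :> R by rewrite invr_gt0.
have s2 : r%:R^-1 <= 2 * sin x by lra.
by rewrite ler_ln ?posrE// (lt_le_trans ri).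
Qed.

End QuantumFactorial.

Section QuantumFactorialBound.
Variable R : realType.
Variable N : nat.
Hypothesis N0 : (0 < N)%N.
Local Notation r := (2 * N + 1)%N.
Local Notation h := (2 * pi / r%:R : R).
Local Notation A := ((33 / 50) / h + ln r%:R + 1 / 5 : R).

Let r0 : (0 < r%:R :> R).
Proof. by rewrite ltr0n addn1. Qed.

Let rE : r%:R = 2 * N%:R + 1 :> R.
Proof. by rewrite natrD natrM. Qed.

Let h0 : 0 < h.
Proof. by rewrite divr_gt0// mulr_gt0// pi_gt0. Qed.

Let lnr : 0 <= ln r%:R :> R.
Proof. by rewrite ln_ge0// ler1n addn1. Qed.

Let A0 : 0 <= (33 / 50) / h.
Proof. by rewrite divr_ge0// ltW. Qed.

(** This absorbs the N terms 1 / 5 of a full sum of [log_sine]; it amounts to 2 pi / 5 <= 33 / 25,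
    up to a positive term. *)
Let N_le : N%:R / 5 <= (33 / 50) / h.
Proof.
have p3 := pi_ge3 R; have p4 := pi_le R.
rewrite ler_pdivlMr// mulrA ler_pdivrMr// rE.
have : 0 <= N%:R :> R by [].
nra.
Qed.

Let hN i : (0 < i <= N)%N -> i%:R * h < pi.
Proof.
move=> /andP[_]; rewrite -(ler_nat R) => iN; have p0 := pi_gt0 R.
rewrite mulrA ltr_pdivrMr// rE; nra.
Qed.

(** The full sum is N / 5 - ln r / 2 because {N}! is its own complement. A positive term lies either
    left of pi / 2, where [sum_log_sine_le_inv] applies, or right of it, where [log_sine]
    increases. *)
Lemma sum_log_sine_low n : (n <= N)%N ->
  \sum_(1 <= i < n.+1) log_sine (i%:R * h) <= A.
Proof.
apply: unimodal_partial_sum.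
- by rewrite !addr_ge0.
- rewrite big_nat_cond (eq_bigr (fun i => 1 / 5 - ln `|curly R r i|)); last first.
    by move=> i; rewrite andbT => iN; rewrite log_sine_low.
  rewrite -big_nat_cond sumrB sumr_const_nat subn1 /= -ln_curly_fact//; last by lia.
  rewrite ln_curly_fact_half// -mulr_natr; have := N_le; have := lnr; lra.
- move=> {}n nN f0; have [nh|nh] := leP (n%:R * h) (pi / 2).
    left; apply: le_trans (sum_log_sine_le_inv h0 nh (ltW f0)) _.
    by rewrite -addrA lerDl addr_ge0.
  right=> i /andP[ni iN]; apply: le_trans (ltW f0) _.
  apply: log_sine_ge; first exact: ltW.
    by rewrite ler_pM2r// ler_nat.
  by apply: hN; lia.
Qed.

(** As in the low range, except that left of pi / 2 the first term is split off and the argument (i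
    + 1) h - h / 2 is compared with the smaller i h. *)
Lemma sum_log_sine_high n : (n <= N)%N ->
  \sum_(1 <= i < n.+1) log_sine (i%:R * h - h / 2) <= A.
Proof.
apply: unimodal_partial_sum.
- by rewrite !addr_ge0.
- rewrite big_nat_cond (eq_bigr (fun i => 1 / 5 - ln `|curly R r (N + i)|)); last first.
    by move=> i; rewrite andbT => iN; rewrite log_sine_high.
  rewrite -big_nat_cond sumrB sumr_const_nat subn1 /=.
  have : \sum_(1 <= i < N.+1) ln `|curly R r (N + i)| =
      ln `|curly_fact R r (2 * N)| - ln `|curly_fact R r N|.
    rewrite !ln_curly_fact//; [|lia..].
    rewrite [in RHS](@big_cat_nat _ _ _ N.+1 1 (2 * N).+1)//=; [|lia].
    rewrite addrAC subrr add0r -[N.+1 in RHS]/(1 + N)%N big_addn.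
    rewrite (_ : ((2 * N).+1 - N = N.+1)%N); last by lia.
    by apply: eq_bigr => i _; rewrite [(N + i)%N]addnC.
  move=> ->; rewrite ln_curly_fact_half// norm_curly_fact -[(2 * N).+1]addn1.
  rewrite prod_curly// -mulr_natr; have := N_le; have := lnr; lra.
- move=> {}n nN f0; have p0 := pi_gt0 R; have [nh|nh] := leP (n%:R * h - h / 2) (pi / 2).
    left; case: n nN f0 nh => // n nN f0 nh.
    rewrite big_ltn//.
    have nh' : n%:R * h <= n.+1%:R * h - h / 2.
      by rewrite -[n.+1%:R]natr1 [(_ + 1) * h]mulrDl mul1r; have := h0; lra.
    have first : log_sine (1 * h - h / 2) <= 1 / 5 + ln r%:R.
      by rewrite (_ : 1 * h - _ = h / 2); [exact: log_sine_first|field; rewrite gt_eqF].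
    have rest : \sum_(2 <= i < n.+2) log_sine (i%:R * h - h / 2) <=
        \sum_(1 <= i < n.+1) log_sine (i%:R * h).
      rewrite big_add1 /= big_nat_cond [leRHS]big_nat_cond.
      apply: ler_sum => i; rewrite andbT ltnS => /andP[i1 i_n].
      have ih : i%:R * h <= n%:R * h by rewrite ler_pM2r// ler_nat.
      have i0 : 0 < i%:R * h by rewrite mulr_gt0// ltr0n.
      have ni : i.+1%:R * h <= n.+1%:R * h by rewrite ler_pM2r// ler_nat.
      apply: log_sine_le => //; last lra.
      by rewrite -[i.+1%:R]natr1 [(_ + 1) * h]mulrDl mul1r; have := h0; lra.
    have f0n : 0 <= log_sine (n%:R * h).
      (* For n = 0 the argument is 0, and the convention ln 0 = 0 makes [log_sine] there equal to 1
         / 5. *)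
      case: n {nN rest} f0 nh nh' => [|n] f0 nh nh'.
        by rewrite mul0r /log_sine sin0 mulr0 ln0// subr0 divr_ge0.
      apply: le_trans (ltW f0) _; apply: log_sine_le => //.
      by rewrite mulr_gt0.
    have := sum_log_sine_le_inv h0 (le_trans nh' nh) f0n.
    lra.
  right=> i /andP[ni iN]; apply: le_trans (ltW f0) _.
  apply: log_sine_ge; first exact: ltW.
    by rewrite lerD2r ler_pM2r// ler_nat.
  have : i%:R * h < pi by apply: hN; lia.
  have := h0; lra.
Qed.

(** The linear correction is the accumulated 1 / 5 of [log_sine]: n terms up to N, and n - N terms
    above, where 2 (n - N) = 2 n - r + 1. In the latter case {N}! contributes ln r / 2 with a
    favourable sign. *)
Lemma ln_curly_fact_ge n : (n < r)%N ->
  - ln `|curly_fact R r n| <=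
  A - (2 * n%:R - (if (N < n)%N then r%:R else 0)) / 10.
Proof.
move=> nr; rewrite ln_curly_fact//; case: ltnP => [Nn|nN]; last first.
  have := sum_log_sine_low nN.
  rewrite big_nat_cond (eq_bigr (fun i => 1 / 5 - ln `|curly R r i|)); last first.
    by move=> i; rewrite andbT => ?; rewrite log_sine_low//; lia.
  rewrite -big_nat_cond sumrB sumr_const_nat subn1 /= -mulr_natr; lra.
have mN : (n - N <= N)%N by lia.
have := sum_log_sine_high mN.
rewrite big_nat_cond (eq_bigr (fun i => 1 / 5 - ln `|curly R r (N + i)|)); last first.
  by move=> i; rewrite andbT => ?; rewrite log_sine_high//; lia.
rewrite -big_nat_cond sumrB sumr_const_nat subn1 /=.
have -> : \sum_(1 <= i < (n - N).+1) ln `|curly R r (N + i)| =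
    \sum_(1 <= i < n.+1) ln `|curly R r i| - ln r%:R / 2.
  rewrite -ln_curly_fact_half// ln_curly_fact//; [|lia].
  rewrite [in RHS](@big_cat_nat _ _ _ N.+1 1 n.+1)//=; [|lia].
  rewrite addrAC subrr add0r -[N.+1 in RHS]/(1 + N)%N big_addn.
  rewrite (_ : (n.+1 - N = (n - N).+1)%N); last by lia.
  by apply: eq_bigr => i _; rewrite [(N + i)%N]addnC.
rewrite -[_ *+ (n - N)]mulr_natr natrB ?(ltnW Nn)// rE; have := lnr; rewrite rE; lra.
Qed.

End QuantumFactorialBound.

(** * Growth of 6j-symbols and of the invariants *)

Section SixJ.
Variable R : realType.
Variable N : nat.
Hypothesis N0 : (0 < N)%N.
Local Notation r := (2 * N + 1)%N.
Local Notation h := (2 * pi / r%:R : R).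
Local Notation A := ((33 / 50) / h + ln r%:R + 1 / 5 : R).

Let r0 : (0 < r%:R :> R).
Proof. by rewrite ltr0n addn1. Qed.

Let rE : r%:R = 2 * N%:R + 1 :> R.
Proof. by rewrite natrD natrM. Qed.

Lemma sum_ln_curly_fact_ge (s : seq nat) : all (fun n => n < r)%N s ->
  - \sum_(n <- s) ln `|curly_fact R r n| <=
  (size s)%:R * A - (2 * (sumn s)%:R - r%:R * (count (fun n => N < n)%N s)%:R) / 10.
Proof.
have := @ln_curly_fact_ge R N N0; move: A => a H.
elim: s => [|n s IH]; first by rewrite big_nil !(mulr0, mul0r, subr0, oppr0).
rewrite [all _ _]/= => /andP[nr /IH {}IH]; rewrite big_cons.
have := H n nr; rewrite [size _]/= [sumn _]/= [count _ _]/=.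
rewrite -[(size s).+1%:R]natr1 [(n + _)%:R]natrD [(_ + count _ _)%:R]natrD.
rewrite [((size s)%:R + 1) * a]mulrDl mul1r [r%:R * (_ + _)]mulrDr; move: IH.
set u := (size s)%:R * a; set v := r%:R * (count _ _)%:R; set w := ln _.
by case: (N < n)%N => h1 h2; rewrite ?mulr1 ?mulr0; lra.
Qed.

Lemma count_large_le (s : seq nat) :
  (N.+1 * count (fun n => N < n)%N s <= sumn s)%N.
Proof.
elim: s => /= [|n s IH]; first by rewrite muln0.
rewrite mulnDr leq_add//.
by case: ltnP; rewrite ?muln1 ?muln0.
Qed.

Lemma ln_curly_fact_compl n : (n < r)%N ->
  ln `|curly_fact R r n| = ln r%:R - ln `|curly_fact R r (2 * N - n)|.
Proof.
move=> nr; rewrite -(curly_fact_reflect R N0 nr).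
rewrite (_ : (r.-1 - n)%N = (2 * N - n)%N); last by lia.
have nr' : (2 * N - n < r)%N by lia.
by rewrite lnM ?posrE ?norm_curly_fact_gt0// addrK.
Qed.

(** Passing to complements turns the three numerators into inverses at a cost of 3 ln r. The four
    indices then add up to 3 r - 2; even if all exceed N, the corrections e_i add up to at least 2
    (3 r - 2) - 4 r = 2 r - 4. *)
Lemma delta_quotient_le x y z : (x + y + z < 2 * N)%N ->
  `|curly_fact R r x * curly_fact R r y * curly_fact R r z /
    curly_fact R r (x + y + z).+1| <=
  expR (4 * A + 3 * ln r%:R - (2 * r%:R - 4) / 10).
Proof.
move=> xyz; rewrite !normrM normfV.
have g n : (n < r)%N -> `|curly_fact R r n| \is Num.pos.
  by move=> nr; rewrite posrE norm_curly_fact_gt0.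
have [xr yr zr Tr] : [/\ x < r, y < r, z < r & (x + y + z).+1 < r]%N by split; lia.
rewrite -ler_ln ?posrE ?expR_gt0 ?mulr_gt0 ?invr_gt0 ?norm_curly_fact_gt0//.
rewrite expRK ln_div ?rpredM ?g// !lnM ?rpredM ?g//.
rewrite (ln_curly_fact_compl xr) (ln_curly_fact_compl yr) (ln_curly_fact_compl zr).
pose s := [:: (2 * N - x)%N; (2 * N - y)%N; (2 * N - z)%N; (x + y + z).+1].
have sr : all (fun n => n < r)%N s by rewrite /= Tr; lia.
have := sum_ln_curly_fact_ge sr.
have -> : sumn s = (6 * N + 1)%N by rewrite /=; lia.
have : r%:R * (count (fun n => N < n)%N s)%:R <= r%:R * 4 :> R.
  by rewrite ler_pM2l// (ler_nat _ _ 4) count_size.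
rewrite !big_cons big_nil addr0 [size s]/= natrD natrM.
have := rE; move: A (r%:R : R) => a q; set k := _%:R.
lra.
Qed.

(** After complementing the numerator, the eight indices add up to 2 N - 1 = r - 2. Two indices
    above N would need 2 N + 2, so at most one reduction modulo r occurs and the corrections add up
    to at least r - 4. *)
Lemma sixj_quotient_le (s : seq nat) : size s = 7%N -> (sumn s < 2 * N)%N ->
  `|curly_fact R r (sumn s).+1 / \prod_(n <- s) curly_fact R r n| <=
  expR (8 * A + ln r%:R - (r%:R - 4) / 10).
Proof.
move=> s7 sN.
have sr : all (fun n => n < r)%N s.
  elim: s sN {s7} => //= n s IH sN; rewrite IH ?andbT; lia.
have p0 : forall s', all (fun n => n < r)%N s' ->
    0 < `|\prod_(n <- s') curly_fact R r n| /\
    ln `|\prod_(n <- s') curly_fact R r n| = \sum_(n <- s') ln `|curly_fact R r n|.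
  elim=> [|n s' IH]; first by rewrite !big_nil normr1 ln1.
  move=> /andP[nr /IH[]]; rewrite !big_cons normrM => H <-.
  by rewrite mulr_gt0 ?norm_curly_fact_gt0// lnM ?posrE ?norm_curly_fact_gt0.
have [{}p0 pE] := p0 s sr.
have Sr : ((sumn s).+1 < r)%N by lia.
rewrite normrM normfV.
rewrite -ler_ln ?posrE ?expR_gt0 ?divr_gt0 ?norm_curly_fact_gt0//.
rewrite expRK ln_div ?posrE ?norm_curly_fact_gt0// pE (ln_curly_fact_compl Sr).
pose s' := (2 * N - (sumn s).+1)%N :: s.
have sr' : all (fun n => n < r)%N s' by rewrite /= sr andbT; lia.
have := sum_ln_curly_fact_ge sr'.
have := count_large_le s'.
have -> : sumn s' = (2 * N - 1)%N by rewrite /=; lia.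
move=> c1; have {}c1 : (count (fun n => N < n)%N s' <= 1)%N.
  by rewrite leqNgt; apply/negP => c2; move: c1; apply/negP; nia.
have : r%:R * (count (fun n => N < n)%N s')%:R <= r%:R * 1 :> R.
  by rewrite ler_pM2l// (ler_nat _ _ 1).
rewrite [size s']/= s7 big_cons natrB; last by lia.
rewrite natrM; have := rE; move: A (r%:R : R) => a q; set k := _%:R.
lra.
Qed.

End SixJ.

(** * Norms of complex numbers *)

Section ComplexNorm.
Variable R : realType.
Local Notation C := (complex R).
Local Open Scope complex_scope.
Local Notation normc := (@ComplexField.Normc.normc R).

Lemma normc_ge0 (x : C) : 0 <= normc x.
Proof. by case: x => a b; rewrite /ComplexField.Normc.normc sqrtr_ge0. Qed.

Lemma normc_real (x : R) : normc x%:C = `|x|.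
Proof. by rewrite /ComplexField.Normc.normc /= expr0n /= addr0 sqrtr_sqr. Qed.

Lemma normc_i : normc 'i = 1.
Proof. by rewrite /ComplexField.Normc.normc /= expr0n expr1n /= add0r sqrtr1. Qed.

Lemma normcX (x : C) n : normc (x ^+ n) = normc x ^+ n.
Proof.
elim: n => [|n IH]; first by rewrite !expr0 ComplexField.Normc.normc1.
by rewrite !exprS ComplexField.Normc.normcM IH.
Qed.

Lemma normc_prod (I : Type) (s : seq I) (P : pred I) (F : I -> C) :
  normc (\prod_(i <- s | P i) F i) = \prod_(i <- s | P i) normc (F i).
Proof.
exact: (big_morph _ (@ComplexField.Normc.normcM R) (ComplexField.Normc.normc1 R)).
Qed.

Lemma normc_sum_le (I : Type) (s : seq I) (P : pred I) (F : I -> C) :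
  normc (\sum_(i <- s | P i) F i) <= \sum_(i <- s | P i) normc (F i).
Proof.
elim/big_ind2: _ => // [|x1 x2 y1 y2 h1 h2].
  by rewrite ComplexField.Normc.normc0.
by apply: le_trans (le_normcD _ _) _; exact: lerD.
Qed.

Lemma normc_csqrt (x : R) : normc (csqrt x) = Num.sqrt `|x|.
Proof.
rewrite /csqrt; case: (leP 0 x) => x0.
  by rewrite normc_real ger0_norm ?sqrtr_ge0// (ger0_norm x0).
by rewrite ComplexField.Normc.normcM normc_i mul1r normc_real ger0_norm ?sqrtr_ge0.
Qed.

End ComplexNorm.

(** * Norms of Delta and of 6j-symbols *)

Section SixJBound.
Variable R : realType.
Variable N : nat.
Hypothesis N0 : (0 < N)%N.
Local Notation r := (2 * N + 1)%N.
Local Notation h := (2 * pi / r%:R : R).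
Local Notation A := ((33 / 50) / h + ln r%:R + 1 / 5 : R).
Local Notation normc := (@ComplexField.Normc.normc R).

Let r0 : (0 < r%:R :> R).
Proof. by rewrite ltr0n addn1. Qed.

Let rE : r%:R = 2 * N%:R + 1 :> R.
Proof. by rewrite natrD natrM. Qed.

Lemma zetaE : zeta R r = 2 * sin h.
Proof. by []. Qed.

(** Compare with [log_sine_first]. Only for r = 3 does h exceed pi / 2, and then sin h = sin (h /
    2). *)
Lemma zeta_ge : r%:R^-1 <= zeta R r.
Proof.
have p0 := pi_gt0 R.
have z0 : 0 < zeta R r.
  by have := @sin_low_gt0 R N 1 N0; rewrite mul1r zetaE => s0; rewrite mulr_gt0.
have h0 : 0 < h by rewrite divr_gt0// mulr_gt0.
suff : log_sine h <= log_sine (h / 2).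
  move=> /le_trans /(_ (log_sine_first R N0)).
  rewrite lerD2l lerNl -lnV ?posrE// -zetaE.
  by rewrite ler_ln ?posrE ?invr_gt0.
have [hp|hp] := leP h (pi / 2).
  by apply: log_sine_le => //; lra.
have N1 : N%:R < 2 :> R.
  move: hp; rewrite ltr_pdivlMr// rE; nra.
have {}N1 : N%:R = 1 :> R.
  by move: N1; rewrite (ltr_nat R N 2) => N1; have -> : N = 1%N by lia.
rewrite -(log_sine_reflect h) le_eqVlt; apply/orP; left; apply/eqP.
by congr log_sine; rewrite rE N1; field.
Qed.

Lemma zeta_gt0 : 0 < zeta R r.
Proof. by apply: lt_le_trans zeta_ge; rewrite invr_gt0. Qed.

Lemma zeta_le2 : zeta R r <= 2.
Proof. by rewrite zetaE ler_piMr// sin_le1. Qed.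

Lemma normc_Delta_le a b c : admissible3 r a b c ->
  normc (Delta R r a b c) ^+ 2 <= 
  2 * expR (4 * A + 3 * ln r%:R - (2 * r%:R - 4) / 10).
Proof.
move=> /and5P[/andP[ao ar] /andP[bo br] /andP[co cr] abc] /and3P[abc1 abc2 abc3].
rewrite /Delta ComplexField.Normc.normcM !normc_csqrt exprMn !sqr_sqrtr ?normr_ge0//.
rewrite ler_pM//; first by rewrite gtr0_norm ?zeta_gt0// zeta_le2.
pose x := ((a + b - c)./2)%N; pose y := ((b + c - a)./2)%N; pose z := ((a + c - b)./2)%N.
have xyz : (x + y + z = (a + b + c)./2)%N by rewrite /x /y /z; lia.
rewrite -/x -/y -/z -xyz; apply: delta_quotient_le => //.
(* Admissibility gives (a + b + c) / 2 <= r - 2 = 2 N - 1. *)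
by rewrite xyz; lia.
Qed.

End SixJBound.

Section SixJSymbolBound.
Variable R : realType.
Variable N : nat.
Hypothesis N0 : (0 < N)%N.
Local Notation r := (2 * N + 1)%N.
Local Notation h := (2 * pi / r%:R : R).
Local Notation X := ((33 / 50) / h : R).
Local Notation A := ((33 / 50) / h + ln r%:R + 1 / 5 : R).
Local Notation normc := (@ComplexField.Normc.normc R).

Let r0 : (0 < r%:R :> R).
Proof. by rewrite ltr0n addn1. Qed.

Lemma curly_fact_vanish n : (r <= n)%N -> curly_fact R r n = 0.
Proof.
move=> rn; rewrite /curly_fact (@big_cat_nat _ _ _ r)//=; [|lia..].
by rewrite [X in _ * X]big_ltn ?ltnS// curly_r mul0r mulr0.
Qed.

(** Since the T_i and the Q_j have equal sums, the seven indices of the denominator add up to z, as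
    [sixj_quotient_le] requires. There are at most 4 N + 1 terms, fewer than 2 r. *)
Lemma sixj_sum_le (T1 T2 T3 T4 Q1 Q2 Q3 : nat) :
  (T1 + T2 + T3 + T4 = Q1 + Q2 + Q3)%N -> (Q1 <= 4 * N)%N ->
  `| \sum_(maxn (maxn T1 T2) (maxn T3 T4) <= z < (minn Q1 (minn Q2 Q3)).+1)
     (-1) ^+ z * curly_fact R r z.+1 /
     (curly_fact R r (z - T1) * curly_fact R r (z - T2) *
      curly_fact R r (z - T3) * curly_fact R r (z - T4) *
      (curly_fact R r (Q1 - z) * curly_fact R r (Q2 - z) * curly_fact R r (Q3 - z))) | <=
  2 * r%:R * expR (8 * A + ln r%:R - (r%:R - 4) / 10).
Proof.
move=> TQ Q1N; set B := expR _.
have B0 : 0 <= B by apply: expR_ge0.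
apply: le_trans (ler_norm_sum _ _ _) _.
apply: le_trans (_ : \sum_(maxn (maxn T1 T2) (maxn T3 T4) <= z < (minn Q1 (minn Q2 Q3)).+1) B <= _).
  rewrite big_nat_cond [leRHS]big_nat_cond; apply: ler_sum => z.
  (* For z + 1 >= r the factorial {z + 1}! contains {r} = 0. *)
  rewrite andbT => zTQ; have [zr|zr] := leqP (2 * N) z.
    by rewrite curly_fact_vanish ?mulr0 ?mul0r ?normr0//; lia.
  pose s := [:: (z - T1); (z - T2); (z - T3); (z - T4); (Q1 - z); (Q2 - z); (Q3 - z)]%N.
  have sz : sumn s = z by rewrite /=; lia.
  have := @sixj_quotient_le R N N0 s erefl; rewrite sz => /(_ zr).
  apply: le_trans; rewrite -mulrA normrM normrX normrN1 expr1n mul1r.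
  rewrite le_eqVlt; apply/orP; left; apply/eqP; congr `|_ / _|.
  by rewrite /s !big_cons big_nil mulr1 !mulrA.
rewrite sumr_const_nat -[B *+ _]mulr_natl ler_wpM2r//.
rewrite -natrM ler_nat; lia.
Qed.

(** Each edge lies in two faces and in two of the quadrilaterals; parity makes every half exact. *)
Lemma sum_half_face_quad a1 a2 a3 a4 a5 a6 :
  ~~ odd a1 -> ~~ odd a2 -> ~~ odd a3 -> ~~ odd a4 -> ~~ odd a5 -> ~~ odd a6 ->
  ((a1 + a2 + a3)./2 + (a1 + a5 + a6)./2 + (a2 + a4 + a6)./2 + (a3 + a4 + a5)./2 =
   (a1 + a2 + a4 + a5)./2 + (a1 + a3 + a4 + a6)./2 + (a2 + a3 + a5 + a6)./2)%N.
Proof.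
have ex a : ~~ odd a -> exists b, a = b.*2 by exists a./2; rewrite even_halfK.
move=> /ex[b1 ->] /ex[b2 ->] /ex[b3 ->] /ex[b4 ->] /ex[b5 ->] /ex[b6 ->].
by rewrite -!doubleD !doubleK; lia.
Qed.

(** Four Deltas contribute the square of the bound on |Delta|^2, so the exponent contains 2 (4 [A])
    + 8 [A] = 16 [A] and the corrections -2 (2 r - 4) / 10 - (r - 4) / 10 = -r / 2 + 6 / 5. The
    constants come to 16 / 5 + 6 / 5 + 3 <= 8, the 3 coming from 2^3 <= exp 3. *)
Lemma normc_sixj_le a1 a2 a3 a4 a5 a6 : admissible6 r a1 a2 a3 a4 a5 a6 ->
  normc (sixj R r a1 a2 a3 a4 a5 a6) <=
  expR (16 * X - r%:R / 2 + 25 * ln r%:R + 8).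
Proof.
move=> /and4P[F1 F2 F3 F4]; rewrite /sixj.
have D1 := normc_Delta_le R N0 F1; have D2 := normc_Delta_le R N0 F2.
have D3 := normc_Delta_le R N0 F3; have D4 := normc_Delta_le R N0 F4.
set M := expR _ in D1 D2 D3 D4.
have M0 : 0 <= M by apply: expR_ge0.
have sq (x : R) : 0 <= x -> x ^+ 2 <= 2 * M -> x <= Num.sqrt (2 * M).
  move=> x0 xM; rewrite -(ger0_norm x0) -sqrtr_sqr ler_sqrt//.
  by rewrite mulr_ge0.
move: D1 D2 D3 D4; move: (Delta R r a1 a2 a3) (Delta R r a2 a4 a6).
move: (Delta R r a1 a5 a6) (Delta R r a3 a4 a5) => d3 d4 d1 d2 D1 D2 D3 D4.
rewrite !ComplexField.Normc.normcM !normc_real normcX normc_i expr1n mulr1.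
set S := (X in _ * _ * X).
have S_le : S <= 2 * r%:R * expR (8 * A + ln r%:R - (r%:R - 4) / 10).
  have even3 a b c : admissible3 r a b c ->
      [/\ ~~ odd a, ~~ odd b & ~~ odd c] /\
      [/\ (a <= r - 3)%N, (b <= r - 3)%N & (c <= r - 3)%N].
    by case/and5P=> /andP[? ?] /andP[? ?] /andP[? ?].
  have [[p1 p2 p3] [b1 b2 b3]] := even3 _ _ _ F1.
  have [[_ p4 p6] [_ b4 b6]] := even3 _ _ _ F2.
  have [[_ p5 _] [_ b5 _]] := even3 _ _ _ F3.
  apply: sixj_sum_le; first exact: sum_half_face_quad.
  rewrite leq_half_double; clear -b1 b2 b4 b5; lia.
have S0 : 0 <= S by rewrite /S normr_ge0.
have DD : normc d1 * normc d2 * normc d3 * normc d4 <= (2 * M) ^+ 2.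
  rewrite -(sqr_sqrtr (mulr_ge0 (ler0n _ 2) M0)) -exprM !exprS expr0 mulr1 !mulrA.
  by rewrite !ler_pM ?mulr_ge0 ?normc_ge0// sq// normc_ge0.
have zi : `|(zeta R r)^-1| <= r%:R.
  rewrite normfV gtr0_norm ?zeta_gt0// -[leRHS]invrK lef_pV2 ?posrE ?zeta_gt0 ?invr_gt0//.
  exact: zeta_ge.
have r_exp : r%:R = expR (ln r%:R) :> R by rewrite lnK ?posrE.
have e2 : 2 <= expR 1 :> R by have := expR_ge1Dx (1 : R).
apply: le_trans (_ : r%:R * (2 * M) ^+ 2 * (2 * r%:R * expR (8 * A + ln r%:R - (r%:R - 4) / 10)) <= _).
  apply: ler_pM => //; first by rewrite !mulr_ge0 ?normc_ge0.
  by apply: ler_pM => //; rewrite ?normr_ge0 ?mulr_ge0 ?normc_ge0.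
rewrite exprMn /M -expRM_natl.
have -> : r%:R * (2 ^+ 2 * expR (2 * (4 * A + 3 * ln r%:R - (2 * r%:R - 4) / 10))) *
   (2 * r%:R * expR (8 * A + ln r%:R - (r%:R - 4) / 10)) =
   2 ^+ 3 * expR (2 * ln r%:R + 2 * (4 * A + 3 * ln r%:R - (2 * r%:R - 4) / 10) +
     (8 * A + ln r%:R - (r%:R - 4) / 10)).
  rewrite !expRD [2 * ln _]mulr_natl mulr2n expRD -r_exp; ring.
have e8 : 2 ^+ 3 <= expR 3 :> R.
  have -> : expR 3 = expR 1 ^+ 3 :> R by rewrite -expRM_natl mulr1.
  by rewrite lerXn2r// nnegrE ?expR_ge0.
apply: le_trans (ler_wpM2r (expR_ge0 _) e8) _.
rewrite -expRD ler_expR; lra.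
Qed.

End SixJSymbolBound.

(** * Growth of the invariants for a fixed triangulation *)

Section TuraevViroBound.
Variable R : realType.
Variables (t : nat) (tau : gluing t) (M : topologicalType).
Local Notation normc := (@ComplexField.Normc.normc R).

(** There are at most r^e colorings, and every factor of a summand other than a 6j-symbol is
    polynomial in r. Only the t symbols grow exponentially; [a] and [b] do not depend on r. *)
Lemma normc_TV_le : exists a b : R, [/\ 0 <= a, 0 <= b &
  forall N, (0 < N)%N -> let r := (2 * N + 1)%N in
  normc (TV R r tau M) <=
  expR (t%:R * (16 * ((33 / 50) / (2 * pi / r%:R)) - r%:R / 2) + a * ln r%:R + b)].
Proof.
set e := #|{: 'I_t * tet_edge}|; set k := #|[pred p in roots (edge_glue tau)]|.
pose K0 := normc (2%:R ^ ((betti2 R M)%:Z - (betti0 R M)%:Z)).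
pose K1 := K0 * 2 ^+ (2 * num_vertices tau) * 2 ^+ k.
(* The powers of r come from the colorings, the edge weights and the 6j-symbols; the absolute value
   keeps [b] nonnegative. *)
exists (e + k + 25 * t)%:R, (`|ln K1| + (8 * t)%:R); split=> [||N N0]; [by []|by rewrite addr_ge0|].
cbv zeta; set r := (2 * N + 1)%N.
have K0_gt0 : 0 < K0.
  rewrite lt0r normc_ge0 andbT; apply/negP => /eqP /ComplexField.Normc.eq0_normc /eqP.
  by rewrite expfz_eq0 pnatr_eq0 andbF.
have K1_gt0 : 0 < K1 by rewrite !mulr_gt0// exprn_gt0.
have r0 : 0 < r%:R :> R by rewrite ltr0n /r addn1.
have r1 : 1 <= r%:R :> R by rewrite ler1n /r addn1.
set Y := 16 * _ - _.
pose S := expR (Y + 25 * ln r%:R + 8).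
have S0 : 0 <= S by apply: expR_ge0.
have z0 := zeta_gt0 R N0.
have edge_le c : `|edge_weight R r c| <= 2 * r%:R.
  rewrite normrM normrX normrN1 expr1n mul1r /qint normrM normfV.
  have -> : sin (2%:R * pi / r%:R) = zeta R r / 2 by rewrite /zeta; field.
  have z2 : 0 < zeta R r / 2 by rewrite divr_gt0.
  rewrite (gtr0_norm z2) ler_pdivrMr// (le_trans (sin_max _))//.
  have := zeta_ge R N0; rewrite -/r => zr.
  have : r%:R * r%:R^-1 <= r%:R * zeta R r by rewrite ler_pM2l.
  rewrite divff ?gt_eqF//; lra.
have term_le (c : {ffun 'I_t * tet_edge -> 'I_r}) : admissible_coloring tau c ->
    normc ((\prod_(p in roots (edge_glue tau)) edge_weight R r (c p))%:C%C *
     \prod_(i < t) on_six_edges (sixj R r) (fun p => nat_of_ord (c p)) i) <=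
    (2 * r%:R) ^+ k * S ^+ t.
  move=> /andP[_ /forallP adm].
  rewrite ComplexField.Normc.normcM normc_real normc_prod normr_prod.
  apply: ler_pM; [exact: prodr_ge0|by apply: prodr_ge0 => i _; apply: normc_ge0| |].
    rewrite /k -prodr_const; apply: ler_prod => p _.
    by rewrite normr_ge0 edge_le.
  rewrite -[t in S ^+ t]card_ord -prodr_const; apply: ler_prod => i _.
  rewrite normc_ge0 /=; exact: (normc_sixj_le R N0 (adm i)).
have eta_le : `|Defs.eta R r| <= 2.
  rewrite normrM normfV (ger0_norm (sqrtr_ge0 _)) ler_pdivrMr ?sqrtr_gt0//.
  rewrite gtr0_norm// (le_trans (zeta_le2 _ _))// ler_peMr//.
  by rewrite -[leLHS]sqrtr1 ler_sqrt// ltW.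
rewrite /TV !ComplexField.Normc.normcM normc_real normrX.
apply: le_trans (_ : K0 * 2 ^+ (2 * num_vertices tau) * (r%:R ^+ e * ((2 * r%:R) ^+ k * S ^+ t)) <= _).
  apply: ler_pM; rewrite ?mulr_ge0 ?normc_ge0 ?exprn_ge0//.
    by rewrite ler_pM2l// lerXn2r// nnegrE.
  apply: le_trans (normc_sum_le _ _ _) _.
  apply: le_trans (ler_sum _ term_le) _.
  apply: le_trans (_ : \sum_(c : {ffun 'I_t * tet_edge -> 'I_r}) (2 * r%:R) ^+ k * S ^+ t <= _).
    rewrite big_mkcond; apply: ler_sum => c _; case: ifP => // _.
    by rewrite mulr_ge0 ?exprn_ge0// mulr_ge0.
  rewrite sumr_const card_ffun card_ord -[_ *+ (_ ^ _)]mulr_natl natrX lexx//.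
rewrite exprMn.
have -> : K0 * 2 ^+ (2 * num_vertices tau) * (r%:R ^+ e * (2 ^+ k * r%:R ^+ k * S ^+ t)) =
  K1 * r%:R ^+ (e + k) * S ^+ t by rewrite /K1 exprD -!mulrA; congr (_ * (_ * _)); rewrite mulrCA.
have -> : r%:R ^+ (e + k) = expR ((e + k)%:R * ln r%:R) :> R.
  by rewrite -[in LHS](lnK (x := r%:R : R)) ?posrE// -expRM_natl.
have K1E : K1 = expR (ln K1) by rewrite lnK ?posrE.
rewrite [X in X * _ * _]K1E /S -(expRM_natl t) -!expRD ler_expR -subr_ge0.
rewrite [leRHS](_ : _ = `|ln K1| - ln K1); first by rewrite subr_ge0 ler_norm.
clear S S0 term_le; move: (ln K1) (ln _) Y => x y w; ring.
Qed.

End TuraevViroBound.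

(** * Passage to the upper limit *)

Section Limsup.
Variable R : realType.

Lemma limn_esup_le_near (u : nat -> \bar R) (l : \bar R) :
  (\forall n \near \oo, (u n <= l)%E) -> (limn_esup u <= l)%E.
Proof.
move=> ul; apply: (@le_trans _ _ (ereal_sup [set u n | n in [set n | (u n <= l)%E]])).
  by apply: ereal_inf_lbound; exists [set n | (u n <= l)%E].
by apply: ge_ereal_sup => _ [n /= ? <-].
Qed.

Lemma ln_le_sqrt (x : R) : 0 < x -> ln x <= 2 * Num.sqrt x.
Proof.
move=> x0; have s0 : 0 < Num.sqrt x by rewrite sqrtr_gt0.
rewrite -[in leLHS](sqr_sqrtr (ltW x0)) expr2 lnM ?posrE//.
have := ln_sublinear s0; lra.
Qed.

Lemma near_log_div_le (a b e : R) : 0 <= a -> 0 <= b -> 0 < e ->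
  \forall n \near \oo, (a * ln n.+1%:R + b) / n.+1%:R <= e.
Proof.
(* Once sqrt n >= 1 and sqrt n >= [W], the numerator is at most (2 a + b) sqrt n <= e n. *)
move=> a0 b0 e0; pose W := (2 * a + b) / e.
have W0 : 0 <= W by rewrite divr_ge0 ?addr_ge0 ?mulr_ge0// ltW.
exists (Num.truncn (W ^+ 2)).+1 => // n /= Wn.
have n0 : 0 < n.+1%:R :> R by [].
have s0 : 0 < Num.sqrt n.+1%:R :> R by rewrite sqrtr_gt0.
have s1 : 1 <= Num.sqrt n.+1%:R :> R.
  by rewrite -[leLHS]sqrtr1 ler_sqrt// ler1n.
have Ws : W <= Num.sqrt n.+1%:R.
  rewrite -[leLHS](ger0_norm W0) -sqrtr_sqr ler_sqrt//.
  by rewrite (le_trans (ltW (truncnS_gt _)))// ler_nat ltnW.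
rewrite ler_pdivrMr// -[n.+1%:R in leRHS](sqr_sqrtr (ltW n0)).
have := ln_le_sqrt n0; set s := Num.sqrt _ in s0 s1 Ws * => ls.
have Wes : 2 * a + b <= e * s by rewrite [e * s]mulrC -ler_pdivrMr.
have h1 : (2 * a + b) * s <= e * s * s by rewrite ler_pM2r.
have h2 : a * ln n.+1%:R <= a * (2 * s) by rewrite ler_wpM2l.
have h3 : b <= b * s by rewrite ler_peMr.
rewrite expr2; lra.
Qed.

(** The case x <= 0 covers vanishing invariants, whose logarithm is -oo. *)
Lemma lne_le (x y : R) : x <= expR y -> (lne x%:E <= y%:E)%E.
Proof.
move=> xy; have [x0|x0] := leP x 0; first by rewrite le0_lneNy// leNye.
by rewrite lne_EFin// lee_fin -[leRHS]expRK ler_ln ?posrE ?expR_gt0.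
Qed.

End Limsup.

Theorem theorem1p3 (R : realType) (M : topologicalType)
    (o : M -> prechain R int M 3) (t : nat) (tau : gluing t) :
  compact_3manifold R M -> is_orientation o -> triangulates R tau M ->
  (LTV R tau M <= (208%:R / 100%:R)%:E * v8 R * (t%:R)%:E)%E.
Proof.
move=> _ _ _.
have [a [b [a0 b0 TVle]]] := normc_TV_le R tau M.
have p0 := pi_gt0 R; have p3 := pi_ge3 R; have p4 := pi_le R.
have t0 : 0 <= t%:R :> R by [].
(* The constant is 16 (33 / 50) - 3, an upper bound for 16 (33 / 50) - pi. *)
apply: (@le_trans _ _ (t%:R * (756 / 100))%:E).
  apply/lee_addgt0Pr => e e0; rewrite -EFinD.
  apply: limn_esup_le_near.
  (* The error is multiplied by 2 pi, which is less than 7. *)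
  have e7 : 0 < e / 7 by rewrite divr_gt0.
  have [n0 _ H] := near_log_div_le a0 b0 e7.
  exists n0 => // n /= n0n.
  set r := (2 * n + 3)%N.
  have rE : r = (2 * n.+1 + 1)%N by rewrite /r; lia.
  have r0 : 0 < r%:R :> R by rewrite ltr0n rE addn1.
  have rS : (r.-1.+1 = r)%N by rewrite rE addn1.
  have {}H : (a * ln r%:R + b) / r%:R <= e / 7.
    have := H r.-1; rewrite rS; apply; rewrite /= rE; lia.
  have := TVle n.+1 isT; rewrite /= -rE => /lne_le L.
  apply: (@le_trans _ _ ((2 * pi / r%:R) * (t%:R * (16 * ((33 / 50) / (2 * pi / r%:R)) - r%:R / 2) +
      a * ln r%:R + b))%:E).
    by rewrite [leRHS]EFinM lee_pmul2l// lte_fin divr_gt0// mulr_gt0.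
  rewrite lee_fin.
  have -> : (2 * pi / r%:R) * (t%:R * (16 * ((33 / 50) / (2 * pi / r%:R)) - r%:R / 2) +
      a * ln r%:R + b) = t%:R * (16 * (33 / 50) - pi) +
      2 * pi * ((a * ln r%:R + b) / r%:R).
    have r_neq0 : r%:R != 0 :> R by rewrite gt_eqF.
    have pi_neq0 : pi != 0 :> R by rewrite gt_eqF.
    move: (pi : R) (r%:R : R) (ln _) pi_neq0 r_neq0 => p q w p_neq0 q_neq0.
    by field; rewrite p_neq0 q_neq0.
  apply: lerD; first by rewrite ler_wpM2l//; lra.
  apply: le_trans (ler_wpM2l _ H) _; first by rewrite mulr_ge0// ltW.
  nra.
(* Numerically, 2.08 times 3.635 is 7.5608. *)
apply: (@le_trans _ _ ((208 / 100)%:E * (3635 / 1000)%:E * t%:R%:E)%E).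
  by rewrite -!EFinM lee_fin mulrC ler_wpM2r//; lra.
by rewrite lee_wpmul2r// lee_wpmul2l// v8_ge.
Qed.
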